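(* Let $W$ be a finite dimensional polynomial $\mathrm{GL}(n,\mathbb{C})$-module, and let $M(H(S(W)); x_1,\ldots,x_n,t)$ and $M'(H(S(W)); v_1,\ldots,v_n,t)$ be the two multiplicity series of $S(W)$ (defined in the context). (i) If $n=2k$, the Hilbert series of the algebra of invariants $S(W)^{\mathrm{Sp}(2k)}$ is $$H(S(W)^{\mathrm{Sp}(2k)},t)=M'(H(S(W));0,1,0,1,\ldots,0,1,t),$$ i.e. one substitutes $v_{2i-1}=0$, $v_{2i}=1$ for $i=1,\ldots,k$. (ii) The Hilbert series of $S(W)^{\mathrm{O}(n)}$ is $H(S(W)^{\mathrm{O}(n)},t)=M_n(t)$, where $M_n$ is defined iteratively by $$M_1(x_2,\ldots,x_n,t)=\tfrac12\bigl(M(H(S(W));-1,x_2,\ldots,x_n,t)+M(H(S(W));1,x_2,\ldots,x_n,t)\bigr),$$ $$M_2(x_3,\ldots,x_n,t)=\tfrac12\bigl(M_1(-1,x_3,\ldots,x_n,t)+M_1(1,x_3,\ldots,x_n,t)\bigr),\quad\ldots,$$ $$M_n(t)=\tfrac12\bigl(M_{n-1}(-1,t)+M_{n-1}(1,t)\bigr).$$ (iii) The Hilbert series of $S(W)^{\mathrm{SO}(n)}$ is $H(S(W)^{\mathrm{SO}(n)},t)=M'_n(t)$, where $$M'_1(v_2,\ldots,v_n,t)=\tfrac12\bigl(M'(H(S(W));-1,v_2,\ldots,v_n,t)+M'(H(S(W));1,v_2,\ldots,v_n,t)\bigr),$$ $$M'_2(v_3,\ldots,v_n,t)=\tfrac12\bigl(M'_1(-1,v_3,\ldots,v_n,t)+M'_1(1,v_3,\ldots,v_n,t)\bigr),\quad\ldots,$$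 $$M'_{n-1}(v_n,t)=\tfrac12\bigl(M'_{n-2}(-1,v_n,t)+M'_{n-2}(1,v_n,t)\bigr),$$ $$M'_n(t)=M'_{n-1}(1,t).$$
   Context: For a partition $\lambda=(\lambda_1,\ldots,\lambda_n)\in\mathbb{N}_0^n$, $\lambda_1\ge\cdots\ge\lambda_n\ge0$, $V^n_\lambda$ denotes the irreducible polynomial $\mathrm{GL}(n,\mathbb{C})$-module of highest weight $\lambda$. $S(W)=\bigoplus_{l\ge0}S^lW$ is the symmetric algebra of $W$, with the diagonal action of $\mathrm{GL}(n,\mathbb{C})$ and of its classical subgroups $\mathrm{O}(n)$, $\mathrm{SO}(n)$ and (when $n=2k$) $\mathrm{Sp}(2k)$ (complex groups). Decompose $$S(W)=\bigoplus_{l\ge0}S^lW=\bigoplus_{l\ge0}\bigoplus_\lambda m_l(\lambda)V^n_\lambda ,$$ where $\lambda$ runs over partitions in $\mathbb{N}_0^n$ and $m_l(\lambda)$ is the multiplicity of $V^n_\lambda$ in $S^lW$. The multiplicity series are $$M(H(S(W));x_1,\ldots,x_n,t)=\sum_{l\ge0}\Bigl(\sum_\lambda m_l(\lambda)x_1^{\lambda_1}\cdots x_n^{\lambda_n}\Bigr)t^l,$$ $$M'(H(S(W));v_1,\ldots,v_n,t)=\sum_{l\ge0}\Bigl(\sum_\lambda m_l(\lambda)v_1^{\lambda_1-\lambda_2}v_2^{\lambda_2-\lambda_3}\cdots v_{n-1}^{\lambda_{n-1}-\lambda_n}v_n^{\lambda_n}\Bigr)t^l .$$ These are formal power series in $t$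 whose coefficients are polynomials in the other variables. In the iterative definitions, the index-$0$ series $M_0$, $M'_0$ are understood as $M(H(S(W));\cdot)$, $M'(H(S(W));\cdot)$. For a subgroup $G\subset\mathrm{GL}(n,\mathbb{C})$, $S(W)^G=\bigoplus_{l\ge0}(S^lW)^G$ is the graded algebra of $G$-invariants, and its Hilbert series is $H(S(W)^G,t)=\sum_{l\ge0}\dim\bigl((S^lW)^G\bigr)t^l$. *)

(* Defs.v *)
From HB Require Import structures.
From Stdlib Require Import Classical ClassicalEpsilon.
From mathcomp Require Import all_boot all_order all_algebra.
From mathcomp Require Import reals.
From mathcomp Require Import complex.
From mathcomp Require Import mpoly.

Set Implicit Arguments.
Unset Strict Implicit.
Unset Printing Implicit Defensive.

Import GRing.Theory.

Local Open Scope ring_scope.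

(* Actions of GL_n(F) on finite-dimensional spaces.  An action is given as a  *)
(* function on all of 'M_n, but only its values on unitmx are ever used.      *)
Section GLActions.
Variables (F : fieldType) (n : nat) (V : vectType F) (a : 'M[F]_n -> 'End(V)).

Definition is_action : Prop :=
  a 1%:M = \1%VF /\
  {in unitmx &, forall g h, a (g *m h) = (a g \o a h)%VF}.

(* The matrix entries of a g are polynomials in the n * n entries of g.       *)
Definition is_polynomial_action : Prop :=
  exists P : 'I_(\dim {:V}) -> 'I_(\dim {:V}) -> {mpoly F[n * n]},
    forall g, g \in unitmx -> forall i j : 'I_(\dim {:V}),
      coord (vbasis {:V}) i (a g (vbasis {:V})`_j) =
      (P i j).@[fun k => mxvec g 0 k].

Definition gl_stable (U : {vspace V}) : Prop :=
  forall g, g \in unitmx -> forall u, u \in U -> a g u \in U.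

Definition gl_irreducible (U : {vspace V}) : Prop :=
  [/\ U != 0%VS, gl_stable U &
      forall U', (U' <= U)%VS -> gl_stable U' -> U' = 0%VS \/ U' = U].

Definition is_partition (lam : 'X_{1..n}) : Prop :=
  forall i j : 'I_n, (i <= j)%N -> (lam j <= lam i)%N.

Definition upper_unitriangular (g : 'M[F]_n) : Prop :=
  forall i j : 'I_n, (j <= i)%N -> g i j = (i == j)%:R.

Definition has_highest_weight (U : {vspace V}) (lam : 'X_{1..n}) : Prop :=
  exists v, [/\ v \in U, v != 0,
    forall g, upper_unitriangular g -> a g v = v &
    forall t : 'rV[F]_n, (forall i, t 0 i != 0) ->
      a (diag_mx t) v = (\prod_i t 0 i ^+ lam i) *: v].

(* V is the direct sum of irreducible submodules U_i, with U_i isomorphic to  *)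
(* V_lam for lam the i-th entry of s.                                         *)
Definition is_decomposition (s : seq 'X_{1..n}) : Prop :=
  exists U : 'I_(size s) -> {vspace V},
    [/\ directv (\sum_i U i)%VS, (\sum_i U i)%VS = fullv &
        forall i, [/\ gl_irreducible (U i), is_partition (tnth (in_tuple s) i) &
                      has_highest_weight (U i) (tnth (in_tuple s) i)]].

(* Polynomial modules are completely reducible and s is unique up to order,   *)
(* so for them the choice only fixes an ordering of the summands.             *)
Definition highest_weights : seq 'X_{1..n} :=
  epsilon (inhabits [::]) is_decomposition.

Definition multiplicity (lam : 'X_{1..n}) : nat := count_mem lam highest_weights.

Definition is_invariant (G : pred 'M[F]_n) (v : V) : Prop :=
  forall g, G g -> a g v = v.

Lemma exists_invariants G :
  exists U : {vspace V}, forall v, v \in U <-> is_invariant G v.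
Proof.
pose ok (U : {vspace V}) := forall v, v \in U -> is_invariant G v.
have ext k (U : {vspace V}) : ok U -> (\dim {:V} - \dim U <= k)%N ->
    exists U' : {vspace V}, forall v, v \in U' <-> is_invariant G v.
  elim: k U => [|k IHk] U okU leUk;
    have [[v [inv_v nUv]]|maxU] := classic (exists v, is_invariant G v /\ v \notin U).
  - have eqU : U = fullv.
      by apply/eqP; rewrite eqEdim subvf -subn_eq0 -leqn0.
    by rewrite eqU memvf in nUv.
  - exists U => v; split=> [/okU//|inv_v].
    by apply/negPn/negP => nUv; apply: maxU; exists v.
  - apply: (IHk (U + <[v]>)%VS) => [_ /memv_addP[u Uu [_ /vlineP[c ->] ->]]|].
      by move=> g Gg; rewrite linearD linearZ /= (okU u Uu g Gg) inv_v.
    have ltU : (\dim U < \dim (U + <[v]>))%N.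
      rewrite ltn_neqAle dimvS ?addvSl // andbT; apply: contra nUv => /eqP dimE.
      have /eqP-> : U == (U + <[v]>)%VS by rewrite eqEdim addvSl dimE leqnn.
      by rewrite (subvP (addvSr U <[v]>)) ?memv_line.
    by rewrite -ltnS (leq_trans _ leUk) // ltn_sub2l // (leq_trans ltU) ?dimvS ?subvf.
  - exists U => v; split=> [/okU//|inv_v].
    by apply/negPn/negP => nUv; apply: maxU; exists v.
apply: (ext (\dim {:V}) 0%VS); last exact: leq_subr.
by move=> v; rewrite memv0 => /eqP-> g _; rewrite linear0.
Qed.

Definition invariants (G : pred 'M[F]_n) : {vspace V} :=
  epsilon (inhabits 0%VS) (fun U => forall v, v \in U <-> is_invariant G v).

Lemma invariantsP G v : v \in invariants G <-> is_invariant G v.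
Proof. exact: (epsilon_spec (inhabits 0%VS) _ (exists_invariants G)). Qed.

End GLActions.

(* The l-th symmetric power of a space with basis 'X_0, ..., 'X_(d-1).        *)
Definition symPow (F : fieldType) (d l : nat) : Type := dhomog d F l.

HB.instance Definition _ (F : fieldType) d l := GRing.Lmodule.copy (symPow F d l) (dhomog d F l).

(* The library makes dhomog d F l a vectType only for d of the form _.+1.     *)
Lemma symPow_vecaxiom (F : fieldType) d l : vector_axiom 'C((l + d).-1, l) (symPow F d l).
Proof.
case: d => [|d]; last by rewrite addnS; exact: dhomog_vecaxiom.
case: l => [|l]; last first.
  rewrite addn0 bin_small //; exists (fun=> 0) => [c p q|].
    by rewrite scaler0 addr0.
  exists (fun=> 0) => [p|r]; last by apply/rowP => -[].
  apply/val_inj/mpolyP => m /=; rewrite mcoeff0; apply/esym.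
  apply: (dhomog_nemf_coeff (mf := mdeg) (d := l.+1)); first exact: dhomog_is_dhomog.
  by rewrite /= mdegE big_ord0.
rewrite bin0; exists (fun p => \row_(i < 1) (val p)@_0) => [c p q|].
  by apply/rowP => i; rewrite !mxE /= mcoeffD mcoeffZ.
have hom (r : 'rV[F]_1) : (r 0 0)%:MP_[0] \is 0.-homog.
  by rewrite -[_%:MP]mulr1 mul_mpolyC dhomogZ // dhomog1.
exists (fun r => DHomog (hom r)) => [p|r]; last first.
  by apply/rowP => i; rewrite mxE /= mcoeffC eqxx mulr1 ord1.
apply/val_inj/mpolyP => m /=; rewrite mcoeffC mxE.
have -> : m = 0%MM by apply/mnmP => -[].
by rewrite eqxx mulr1.
Qed.

HB.instance Definition _ (F : fieldType) d l :=
  Lmodule_hasFinDim.Build F (symPow F d l) (@symPow_vecaxiom F d l).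

Section SymmetricAction.
Variables (F : fieldType) (n : nat) (V : vectType F) (a : 'M[F]_n -> 'End(V)).

Let d := \dim {:V}.
Let e := vbasis {:V}.

(* a g e_i, for 'X_j standing for the basis vector e_j.                       *)
Definition sym_subst (g : 'M[F]_n) : d.-tuple {mpoly F[d]} :=
  [tuple \sum_(j < d) coord e j (a g e`_i) *: 'X_j | i < d].

Lemma sym_subst_homog l g (f : symPow F d l) :
  val f \mPo sym_subst g \is l.-homog.
Proof.
rewrite comp_mpolyE big_seq rpred_sum // => m m_f; apply: rpredZ.
have {1}-> : l = (\sum_(i < d) 1 * m i)%N.
  under eq_bigr do rewrite mul1n.
  by rewrite -mdegE; apply/esym/(dhomog_mf (dhomog_is_dhomog f) m_f).
apply: (big_ind2 (fun (p : {mpoly F[d]}) k => p \is k.-homog)) => [|p j q k|i _].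
- exact: dhomog1.
- exact: dhomogM.
apply: dhomogMn; rewrite tnth_mktuple rpred_sum // => j _.
by rewrite rpredZ // dhomogX /= mdeg1.
Qed.

Definition sym_fun l (g : 'M[F]_n) (f : symPow F d l) : symPow F d l :=
  DHomog (sym_subst_homog g f).

Definition sym_act l (g : 'M[F]_n) : 'End(symPow F d l) := linfun (@sym_fun l g).

Lemma sym_actE l g (f : symPow F d l) :
  val (sym_act l g f) = val f \mPo sym_subst g.
Proof.
have lin : linear (@sym_fun l g).
  by move=> c p q; apply/val_inj; rewrite /= comp_mpolyD comp_mpolyZ.
pose L := HB.pack_for {linear symPow F d l -> symPow F d l}
  (@sym_fun l g) (GRing.isLinear.Build _ _ _ _ _ lin).
by rewrite /sym_act (lfunE L).
Qed.

End SymmetricAction.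

Record polyGLmod (R : realType) (n : nat) := PolyGLmod {
  glmod_sort :> vectType R[i];
  glact : 'M[R[i]]_n -> 'End(glmod_sort);
  glact_action : is_action glact;
  glact_polynomial : is_polynomial_action glact }.

Section Series.
Variables (R : realType) (n : nat) (W : polyGLmod R n).

Definition sym_glact (l : nat) (g : 'M[R[i]]_n) := sym_act (@glact R n W) l g.

(* A power series in t is the sequence of its coefficients.                   *)
Definition hilbert_invariants (G : pred 'M[R[i]]_n) : nat -> rat :=
  fun l => (\dim (invariants (sym_glact l) G))%:R.

(* m_l(lam), and the finitely many lam for which it is nonzero.               *)
Definition sym_mult (l : nat) (lam : 'X_{1..n}) : nat :=
  multiplicity (sym_glact l) lam.
Definition sym_weights (l : nat) : seq 'X_{1..n} :=
  undup (highest_weights (sym_glact l)).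

Definition mult_series : nat -> {mpoly rat[n]} :=
  fun l => \sum_(lam <- sym_weights l) (sym_mult l lam)%:R *: 'X_[lam].

(* The exponents (lam_1 - lam_2, ..., lam_{n-1} - lam_n, lam_n); the default  *)
(* value of nth gives lam_{n+1} = 0.                                          *)
Definition mnm_gaps (lam : 'X_{1..n}) : 'X_{1..n} :=
  [multinom (lam i - nth 0 lam i.+1)%N | i < n].

Definition mult_series' : nat -> {mpoly rat[n]} :=
  fun l => \sum_(lam <- sym_weights l) (sym_mult l lam)%:R *: 'X_[mnm_gaps lam].

End Series.

Section IteratedSubstitution.
Variable n : nat.
Implicit Type M : nat -> {mpoly rat[n]}.

(* Substitution of c for the variable of 0-based index k.                     *)
Definition subst_var (k : nat) (c : rat) M : nat -> {mpoly rat[n]} :=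
  fun l => M l \mPo [tuple if k == i then c%:MP else 'X_i | i < n].

(* M_k, kept in the polynomial ring in all n variables although the first k   *)
(* of them no longer occur in it.                                             *)
Fixpoint iter_mean M (k : nat) : nat -> {mpoly rat[n]} :=
  if k is k'.+1 then
    fun l => 2%:R^-1 *: (subst_var k' (-1) (iter_mean M k') l +
                         subst_var k' 1 (iter_mean M k') l)
  else M.

End IteratedSubstitution.

Section ClassicalGroups.
Variables (F : fieldType) (n : nat).

Definition orthogonal_group : pred 'M[F]_n := [pred g | g^T *m g == 1%:M].

Definition special_orthogonal_group : pred 'M[F]_n :=
  [pred g | (g^T *m g == 1%:M) && (\det g == 1)].

(* The block matrix (0 1; -1 0), for even n.                                  *)
Definition symplectic_form : 'M[F]_n :=
  \matrix_(i, j) ((j == (i + n./2)%N :> nat)%:R - (i == (j + n./2)%N :> nat)%:R).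

Definition symplectic_group : pred 'M[F]_n :=
  [pred g | g^T *m symplectic_form *m g == symplectic_form].

End ClassicalGroups.

(* Main.v *)
Require Import Defs.
From HB Require Import structures.
From Stdlib Require Import Classical ClassicalEpsilon.
From mathcomp Require Import all_boot all_order fingroup perm all_algebra.
From mathcomp Require Import reals.
From mathcomp Require Import complex.
From mathcomp Require Import mpoly.
From mathcomp Require ssrcomplements.

Set Implicit Arguments.
Unset Strict Implicit.
Unset Printing Implicit Defensive.

Import GRing.Theory Num.Theory.

Local Open Scope ring_scope.

(** The invariants of G in S^l W are counted on a decomposition of S^l W into
    irreducible modules, so that the theorem reduces to two facts about GL(n):
    polynomial modules are completely reducible, with highest weight vectors in
    the summands, and an irreducible module U of highest weight lam has a line of
    G-invariants if lam satisfies a condition that depends on G, and only the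
    invariant 0 otherwise.  The condition is lam_1 = lam_2, lam_3 = lam_4, ... for
    Sp(2k), all lam_i even for O(n), all lam_i of the same parity for SO(n).  The
    substitutions in the multiplicity series extract exactly the terms with these
    exponents.

    Complete reducibility comes from a hermitian form for which g and its
    conjugate transpose are adjoint (exists_inv_form): orthogonal complements of
    submodules are then submodules (stable_complement).  Such a form exists on
    polynomials in the entries of a matrix, where g acts by right translation: it is
    Fischer's form, in which multiplication by a variable is adjoint to
    differentiation (hfischer_rtrans).  Every polynomial module embeds in a power
    of that space by its matrix coefficients.  Weight vectors of maximal height are highest
    weight vectors (exists_highest_weight).

    Let v be a highest weight vector of U.  The functional u |-> <u, v> is
    multiplied by b^lam under a lower triangular matrix b (form_lower), and no
    nonzero u has <g u, v> = 0 for all g.  Let p be such that almost every matrix is a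
    product b p k with b lower triangular and k in G.  A G-invariant u is determined by
    <p u, v> (invariant_eq0); hence invariants form at most a line, and
    comparing <p u, v> with <t p u, v> for diagonal t in p G p^-1 gives the condition
    on lam (invariant_torus).  The density statements are matrix factorizations:
    g g^T = b b^T for orthogonal groups, and g J g^T = b J' b^T for the symplectic
    group, with J' the block diagonal form with blocks (0 1; -1 0).

    Conversely, an invariant of U is obtained from any nonzero polynomial f on
    matrices with f (b g k) = b^lam f (g) for k in G (exists_invariant).  Such
    polynomials are products of leading minors of g g^T and of det g for the orthogonal
    groups, and products of Pfaffians of leading blocks of g J g^T for the symplectic
    group. *)

(** * Polynomials and their values *)

Lemma poly_ext_neq0 (F : numFieldType) (p q : {poly F}) :
  (forall s, s != 0 -> p.[s] = q.[s]) -> p = q.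
Proof.
move=> eq_pq; apply/eqP; rewrite -subr_eq0; apply/eqP.
pose rs := [seq (i.+1)%:R : F | i <- iota 0 (size (p - q))].
apply: (@roots_geq_poly_eq0 _ _ rs); last by rewrite size_map size_iota.
  apply/allP => _ /mapP[i _ ->]; rewrite /root hornerD hornerN.
  by rewrite eq_pq ?subrr // pnatr_eq0.
by rewrite map_inj_uniq ?iota_uniq // => i j /eqP; rewrite eqr_nat => /eqP[].
Qed.

Lemma digits_inj D n (f g : nat -> nat) :
  (forall k, f k < D)%N -> (forall k, g k < D)%N ->
  (\sum_(k < n) f k * D ^ k = \sum_(k < n) g k * D ^ k)%N ->
  forall k, (k < n)%N -> f k = g k.
Proof.
elim: n f g => // n IHn f g ltf ltg.
have shift (h : nat -> nat) : (\sum_(k < n.+1) h k * D ^ k =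
    (\sum_(k < n) h k.+1 * D ^ k) * D + h 0)%N.
  rewrite big_ord_recl /= muln1 addnC big_distrl /=; congr (_ + _)%N.
  by apply: eq_bigr => i _; rewrite -mulnA -expnSr.
rewrite !shift => eq_fg.
have D_gt0 : (0 < D)%N by apply: leq_ltn_trans (ltf 0%N).
have eq0 : f 0%N = g 0%N.
  by have := congr1 (modn^~ D) eq_fg; rewrite /= !modnMDl !modn_small.
case=> [|k] //; rewrite ltnS; move: k; apply: (IHn (f \o S) (g \o S)) => [k|k|] /=.
- exact: ltf.
- exact: ltg.
have := congr1 (divn^~ D) eq_fg.
by rewrite /= !divnMDl // !divn_small // !addn0.
Qed.

Lemma mpoly_subst_poly (F : comNzRingType) N (P : {mpoly F[N]})
    (c : 'I_N -> {poly F}) :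
  exists p : {poly F}, forall s, P.@[fun k => (c k).[s]] = p.[s].
Proof.
exists (\sum_(m <- msupp P) P@_m *: \prod_i c i ^+ m i) => s.
rewrite mevalE horner_sum; apply: eq_bigr => m _.
rewrite hornerZ horner_prod; congr (_ * _); apply: eq_bigr => i _.
by rewrite horner_exp.
Qed.

(** Kronecker's substitution X_k := s ^ (D ^ k), for D larger than every
    exponent, keeps distinct monomials distinct, so the univariate case
    applies. *)
Lemma mpoly_eq0_torus (F : numFieldType) N (P : {mpoly F[N]}) :
  (forall x, (forall k, x k != 0) -> P.@[x] = 0) -> P = 0.
Proof.
move=> P0; pose D := (msize P).+1.
pose w (m : 'X_{1..N}) := (\sum_k m k * D ^ k)%N.
pose p : {poly F} := \sum_(m <- msupp P) P@_m *: 'X^(w m).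
have p0 : p = 0.
  apply: poly_ext_neq0 => s s_neq0; rewrite horner0 -[RHS](P0 (fun k => s ^+ (D ^ k))).
    rewrite mevalE horner_sum; apply: eq_bigr => m _; rewrite hornerZ hornerXn.
    congr (_ * _); rewrite /w -prodrXr; apply: eq_bigr => i _.
    by rewrite -exprM mulnC.
  by move=> k; rewrite expf_neq0.
have lt_D m : m \in msupp P -> forall k, (m k < D)%N.
  move=> /msize_mdeg_lt ltm k; rewrite ltnS; apply: leq_trans (ltnW ltm).
  by rewrite mdegE (bigD1 k) //= leq_addr.
have w_inj : {in msupp P &, injective w}.
  move=> m1 m2 m1P m2P eq_w; apply/mnmP => i.
  pose f (m : 'X_{1..N}) k := if insub k is Some i then m i else 0%N.
  have fE m (k : 'I_N) : f m k = m k by rewrite /f valK.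
  rewrite -!fE; apply: (@digits_inj D N) => //.
  - by move=> k; rewrite /f; case: insub => // j; apply: lt_D.
  - by move=> k; rewrite /f; case: insub => // j; apply: lt_D.
  - under eq_bigr do rewrite fE; under [RHS]eq_bigr do rewrite fE; exact: eq_w.
apply/mpolyP => m; rewrite mcoeff0.
case: (boolP (m \in msupp P)) => [mP|/memN_msupp_eq0 //].
have := congr1 (fun q : {poly F} => q`_(w m)) p0.
rewrite coef0 /p coef_sum (bigD1_seq m) ?msupp_uniq //=.
rewrite coefZ coefXn eqxx mulr1 big_seq_cond big1 ?addr0 // => m' /andP[m'P ne].
rewrite coefZ coefXn; case: eqP => [/w_inj eq_m|]; last by rewrite mulr0.
by rewrite eq_m ?eqxx // in ne.
Qed.

Lemma mpoly_ext (F : numFieldType) N (P Q : {mpoly F[N]}) :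
  (forall y : 'rV[F]_N, P.@[y 0] = Q.@[y 0]) -> P = Q.
Proof.
move=> eqPQ; apply/eqP; rewrite -subr_eq0; apply/eqP/mpoly_eq0_torus => x _.
have := eqPQ (\row_k x k); rewrite mevalB.
have xE k : (\row_k x k) 0 k = x k by rewrite mxE.
by rewrite (meval_eq _ xE) (meval_eq Q xE) => ->; rewrite subrr.
Qed.

Lemma mcoeff0_meval (F : comNzRingType) N (P : {mpoly F[N]}) :
  P@_0%MM = P.@[fun=> 0].
Proof.
rewrite {1}[P]mpolyE mevalE raddf_sum /=; apply: eq_bigr => m _.
rewrite mcoeffZ mcoeffX; case: (eqVneq m 0%MM) => [->|m_neq0].
  by rewrite big1 // => i _; rewrite mnm0E expr0.
have [i mi] : exists i, m i != 0%N.
  apply/existsP; apply: contraR m_neq0; rewrite negb_exists => /forallP m0.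
  by apply/eqP/mnmP => i; rewrite mnm0E; apply/eqP/negPn/m0.
by rewrite (bigD1 i) //= expr0n (negPf mi) mul0r.
Qed.

(** * Polynomial functions of a square matrix *)

Section PolynomialFunctions.
Variables (F : numFieldType) (n : nat).
Implicit Types (g : 'M[F]_n) (phi psi : 'M[F]_n -> F).

Definition mxeval (P : {mpoly F[n * n]}) g : F := P.@[fun k => mxvec g 0 k].

Definition polyfun phi := exists P, forall g, phi g = mxeval P g.

Lemma mxeval_inj P Q : (forall g, mxeval P g = mxeval Q g) -> P = Q.
Proof.
move=> eqPQ; apply: mpoly_ext => y; have := eqPQ (vec_mx y).
rewrite /mxeval.
have yE : (fun k => mxvec (vec_mx y) 0 k) =1 y 0 by move=> k; rewrite vec_mxK.
by rewrite !(meval_eq _ yE).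
Qed.

Lemma eq_polyfun phi psi : phi =1 psi -> polyfun phi -> polyfun psi.
Proof. by move=> eq_f [P PE]; exists P => g; rewrite -eq_f. Qed.

Lemma polyfun_const c : polyfun (fun=> c).
Proof. by exists c%:MP => g; rewrite /mxeval mevalC. Qed.

Lemma polyfun_entry i j : polyfun (fun g => g i j).
Proof.
by exists 'X_(mxvec_index i j) => g; rewrite /mxeval mevalXU mxvecE.
Qed.

Lemma polyfunD phi psi :
  polyfun phi -> polyfun psi -> polyfun (fun g => phi g + psi g).
Proof.
by move=> [P PE] [Q QE]; exists (P + Q) => g; rewrite PE QE /mxeval mevalD.
Qed.

Lemma polyfunM phi psi :
  polyfun phi -> polyfun psi -> polyfun (fun g => phi g * psi g).
Proof.
by move=> [P PE] [Q QE]; exists (P * Q) => g; rewrite PE QE /mxeval mevalM.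
Qed.

Lemma polyfunN phi : polyfun phi -> polyfun (fun g => - phi g).
Proof. by move=> [P PE]; exists (- P) => g; rewrite PE /mxeval mevalN. Qed.

Lemma polyfun_sum (I : Type) (r : seq I) (A : pred I) (f : I -> 'M[F]_n -> F) :
  (forall i, A i -> polyfun (f i)) -> polyfun (fun g => \sum_(i <- r | A i) f i g).
Proof.
move=> pf; elim: r => [|i r IHr].
  by apply: eq_polyfun (polyfun_const 0) => g; rewrite big_nil.
case Ai: (A i); last by apply: eq_polyfun IHr => g; rewrite big_cons Ai.
by apply: eq_polyfun (polyfunD (pf i Ai) IHr) => g; rewrite big_cons Ai.
Qed.

Lemma polyfun_prod (I : Type) (r : seq I) (A : pred I) (f : I -> 'M[F]_n -> F) :
  (forall i, A i -> polyfun (f i)) -> polyfun (fun g => \prod_(i <- r | A i) f i g).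
Proof.
move=> pf; elim: r => [|i r IHr].
  by apply: eq_polyfun (polyfun_const 1) => g; rewrite big_nil.
case Ai: (A i); last by apply: eq_polyfun IHr => g; rewrite big_cons Ai.
by apply: eq_polyfun (polyfunM (pf i Ai) IHr) => g; rewrite big_cons Ai.
Qed.

Lemma polyfunX phi k : polyfun phi -> polyfun (fun g => phi g ^+ k).
Proof.
by move=> [P PE]; exists (P ^+ k) => g; rewrite PE /mxeval rmorphXn.
Qed.

Lemma polyfun_mulmx m r q (A : 'M[F]_n -> 'M[F]_(m, r)) (B : 'M[F]_n -> 'M[F]_(r, q)) :
  (forall i j, polyfun (fun g => A g i j)) ->
  (forall i j, polyfun (fun g => B g i j)) ->
  forall i j, polyfun (fun g => (A g *m B g) i j).
Proof.
move=> pA pB i j.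
apply: (@eq_polyfun (fun g => \sum_k A g i k * B g k j)) => [g|].
  by rewrite mxE.
by apply: polyfun_sum => k _; apply: polyfunM.
Qed.

Lemma polyfun_det m (A : 'M[F]_n -> 'M[F]_m) :
  (forall i j, polyfun (fun g => A g i j)) -> polyfun (fun g => \det (A g)).
Proof.
move=> pA; rewrite /determinant; apply: polyfun_sum => s _.
by apply: polyfunM; [apply: polyfun_const | apply: polyfun_prod].
Qed.

(** Polynomials form a domain, so that a function vanishing off the zeros of
    a nonzero polynomial vanishes: this is the density of the sets on which
    the factorizations of matrices below exist. *)
Lemma polyfun_dense phi q g0 : polyfun phi -> polyfun q -> q g0 != 0 ->
  (forall g, q g != 0 -> phi g = 0) -> forall g, phi g = 0.
Proof.
move=> [P PE] [Q QE] q_neq0 phi0 g.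
have /eqP : P * Q = 0.
  apply: mxeval_inj => h; rewrite /mxeval meval0 mevalM.
  rewrite -[_.@[_]]/(mxeval P h) -PE -[_.@[_]]/(mxeval Q h) -QE.
  by have [->|/phi0->] := eqVneq (q h) 0; rewrite ?mulr0 ?mul0r.
rewrite mulf_eq0 => /orP[] /eqP eq0; first by rewrite PE eq0 /mxeval meval0.
by rewrite QE eq0 /mxeval meval0 eqxx in q_neq0.
Qed.

Lemma polyfun_unit_eq phi psi : polyfun phi -> polyfun psi ->
  {in unitmx, phi =1 psi} -> phi =1 psi.
Proof.
move=> pphi ppsi eq_f g; apply/eqP; rewrite -subr_eq0; apply/eqP.
apply: (@polyfun_dense (fun g => phi g - psi g) determinant 1%:M).
- by apply: polyfunD => //; apply: polyfunN.
- by apply: polyfun_det => i j; apply: polyfun_entry.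
- by rewrite det1 oner_neq0.
- by move=> h; rewrite -unitfE -unitmxE => /eq_f->; rewrite subrr.
Qed.

End PolynomialFunctions.

(** * The Fischer form *)

Section LinearSubstitution.
Variables (F : numFieldType) (N : nat).
Implicit Types (f h : {mpoly F[N]}) (L : 'M[F]_N).

(** Column i of L holds the coefficients of the form substituted for X_i, so that
    evaluation at a row vector y becomes evaluation at y *m L. *)
Definition lin_subst L f : {mpoly F[N]} :=
  f \mPo [tuple \sum_j L j i *: 'X_j | i < N].

Lemma lin_subst_eval L f (y : 'rV_N) : (lin_subst L f).@[y 0] = f.@[(y *m L) 0].
Proof.
rewrite comp_mpoly_meval; apply: meval_eq => i; rewrite tnth_mktuple mxE.
by rewrite raddf_sum /=; apply: eq_bigr => j _; rewrite mevalZ mevalXU mulrC.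
Qed.

Lemma lin_substM L1 L2 f :
  lin_subst (L1 *m L2) f = lin_subst L1 (lin_subst L2 f).
Proof. by apply: mpoly_ext => y; rewrite !lin_subst_eval mulmxA. Qed.

Lemma lin_subst1 f : lin_subst 1%:M f = f.
Proof. by apply: mpoly_ext => y; rewrite !lin_subst_eval mulmx1. Qed.

Lemma mpoly_alg_ind (A : {mpoly F[N]} -> Prop) :
  (forall c, A c%:MP) -> (forall i, A 'X_i) ->
  (forall f h, A f -> A h -> A (f + h)) ->
  (forall f h, A f -> A h -> A (f * h)) -> forall f, A f.
Proof.
move=> AC AX AD AM f; rewrite [f]mpolyE.
apply: big_ind => [||m _]; [by rewrite -mpolyC0| by [] |].
rewrite -mul_mpolyC; apply: (AM _ _ (AC _)); rewrite mpolyXE_id.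
apply: big_ind => [||i _]; [by rewrite -mpolyC1| by [] |].
elim: (m i) => [|k IHk]; first by rewrite expr0 -mpolyC1.
by rewrite exprS; apply: AM.
Qed.

Lemma mderiv_lin_subst L i h :
  (lin_subst L h)^`M(i) = \sum_j L i j *: lin_subst L h^`M(j).
Proof.
rewrite /lin_subst; elim/mpoly_alg_ind: h => [c|k|f h IHf IHh|f h IHf IHh].
- rewrite comp_mpolyC mderivC big1 // => j _.
  by rewrite mderivC comp_mpoly0 scaler0.
- rewrite comp_mpolyXU -tnth_nth tnth_mktuple raddf_sum /=.
  rewrite (bigD1 i) //= [RHS](bigD1 k) //= !mderivZ !mderivX.
  rewrite !mnm1E !eqxx !scale1r !big1 => [|j ne|j ne].
  + have submm (m : 'X_{1..N}) : (m - m = 0)%MM.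
      by apply/mnmP => j; rewrite mnmBE mnm0E subnn.
    by rewrite !addr0 !submm mpolyX0 comp_mpoly1.
  + by rewrite mderivX mnm1E eq_sym (negPf ne) scale0r comp_mpoly0 scaler0.
  + by rewrite mderivZ mderivX mnm1E (negPf ne) scale0r scaler0.
- rewrite comp_mpolyD mderivD IHf IHh -big_split /=; apply: eq_bigr => j _.
  by rewrite mderivD comp_mpolyD scalerDr.
- rewrite rmorphM mderivM IHf IHh mulr_suml mulr_sumr -big_split /=.
  apply: eq_bigr => j _; rewrite mderivM comp_mpolyD !rmorphM /= scalerDr.
  by rewrite -scalerAl -scalerAr.
Qed.

Lemma lin_subst_coef0 L h : (lin_subst L h)@_0%MM = h@_0%MM.
Proof.
rewrite !mcoeff0_meval.
have zE : (fun=> 0) =1 (0 : 'rV[F]_N) 0 by move=> i; rewrite mxE.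
by rewrite (meval_eq _ zE) lin_subst_eval mul0mx -(meval_eq _ zE).
Qed.

End LinearSubstitution.

Section Fischer.
Variables (F : numFieldType) (N : nat).
Implicit Types (f h : {mpoly F[N]}) (m : 'X_{1..N}).

Definition mnm_fact m := (\prod_i (m i)`!)%N.

(** The value at 0 of f (d/dX) h. *)
Definition fischer f h : F :=
  \sum_(m <- msupp f) (mnm_fact m)%:R * f@_m * h@_m.

Lemma fischerwE k f h : (msize f <= k)%N ->
  fischer f h = \sum_(m : 'X_{1..N < k}) (mnm_fact m)%:R * f@_m * h@_m.
Proof.
move=> lt_fk; pose I : subFinType _ := 'X_{1..N < k}.
rewrite /fischer (ssrcomplements.big_mksub I) ?msupp_uniq //=; last first.
  by move=> m /msize_mdeg_lt /leq_trans; apply.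
rewrite big_rmcond //= => m /memN_msupp_eq0 ->.
by rewrite mulr0 mul0r.
Qed.

Lemma fischerC f h : fischer f h = fischer h f.
Proof.
rewrite (@fischerwE (maxn (msize f) (msize h))) ?leq_maxl //.
rewrite (@fischerwE (maxn (msize f) (msize h)) h) ?leq_maxr //.
by apply: eq_bigr => m _; rewrite mulrAC.
Qed.

Lemma fischer_is_linear f : linear_for *%R (fischer f).
Proof.
move=> c h1 h2; rewrite /fischer mulr_sumr -big_split; apply: eq_bigr => m _.
by rewrite /= mcoeffD mcoeffZ mulrDr; congr (_ + _); rewrite mulrCA.
Qed.

HB.instance Definition _ f :=
  GRing.isLinear.Build F {mpoly F[N]} F _ (fischer f) (fischer_is_linear f).

Lemma fischerDl f1 f2 h : fischer (f1 + f2) h = fischer f1 h + fischer f2 h.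
Proof. by rewrite !(fischerC _ h) raddfD. Qed.

Lemma fischerZl c f h : fischer (c *: f) h = c * fischer f h.
Proof. by rewrite !(fischerC _ h) linearZ. Qed.

Lemma fischer_suml (I : Type) (r : seq I) (A : pred I) (f : I -> {mpoly F[N]}) h :
  fischer (\sum_(i <- r | A i) f i) h = \sum_(i <- r | A i) fischer (f i) h.
Proof. by rewrite fischerC raddf_sum; apply: eq_bigr => i _; rewrite fischerC. Qed.

Lemma fischerXm m h : fischer 'X_[m] h = (mnm_fact m)%:R * h@_m.
Proof. by rewrite /fischer msuppX big_seq1 mcoeffX eqxx mulr1. Qed.

Lemma fischerMX i f h : fischer ('X_i * f) h = fischer f h^`M(i).
Proof.
rewrite {1}[f]mpolyE mulr_sumr fischer_suml [RHS]/fischer.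
apply: eq_bigr => m _; rewrite -scalerAr -mpolyXD fischerZl fischerXm.
rewrite mcoeff_mderiv [(U_(i) + m)%MM]addmC.
have -> : mnm_fact (m + U_(i)) = (mnm_fact m * (m i).+1)%N.
  rewrite /mnm_fact (bigD1 i) //= [in RHS](bigD1 i) //= mnmDE mnm1E eqxx addn1.
  rewrite factS -mulnA mulnC; congr (_ * _ * _)%N.
  by apply: eq_bigr => j ne; rewrite mnmDE mnm1E eq_sym (negPf ne) addn0.
by rewrite natrM -[h@__ *+ _]mulr_natr -!mulrA mulrCA [_.+1%:R * _]mulrC.
Qed.

(** Multiplication by a variable being adjoint to differentiation, the
    chain rule makes substitution of linear forms adjoint to substitution
    with the transposed matrix. *)
Lemma fischer_lin_subst (L : 'M_N) f h :
  fischer (lin_subst L f) h = fischer f (lin_subst L^T h).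
Proof.
(* The class of the g such that multiplication by g preserves adjointness is
   closed under products, and contains the variables. *)
suffices adj g : forall f' : {mpoly F[N]},
    (forall h', fischer (lin_subst L f') h' = fischer f' (lin_subst L^T h')) ->
    forall h', fischer (lin_subst L (g * f')) h' =
      fischer (g * f') (lin_subst L^T h').
  rewrite -[f]mulr1; apply: adj => {f}h'.
  rewrite /lin_subst rmorph1 -/(lin_subst _ _) -[1]mpolyX0 !fischerXm.
  by rewrite lin_subst_coef0.
elim/mpoly_alg_ind: g => [c|i|g1 g2 IH1 IH2|g1 g2 IH1 IH2] f' IHf h'.
- by rewrite mul_mpolyC /lin_subst comp_mpolyZ !fischerZl IHf.
- rewrite fischerMX mderiv_lin_subst raddf_sum /= {1}/lin_subst rmorphM /=.
  rewrite comp_mpolyXU -tnth_nth tnth_mktuple mulr_suml fischer_suml.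
  apply: eq_bigr => j _; rewrite -scalerAl fischerZl fischerMX.
  by rewrite linearZ /= mxE; congr (_ * _); apply: IHf.
- rewrite mulrDl /lin_subst comp_mpolyD !fischerDl.
  by congr (_ + _); [apply: IH1 | apply: IH2].
- by rewrite -mulrA; apply/IH1/IH2.
Qed.

End Fischer.

Section Hermitian.
Variables (F : numClosedFieldType) (N : nat).
Implicit Types (f h : {mpoly F[N]}).

Definition hfischer f h : F := fischer f (map_mpoly Num.conj h).

Lemma hfischerDl f1 f2 h : hfischer (f1 + f2) h = hfischer f1 h + hfischer f2 h.
Proof. exact: fischerDl. Qed.

Lemma hfischerZl c f h : hfischer (c *: f) h = c * hfischer f h.
Proof. exact: fischerZl. Qed.

Lemma hfischer_conj f h : hfischer h f = (hfischer f h)^*.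
Proof.
pose k := maxn (maxn (msize f) (msize (map_mpoly Num.conj h))) (msize h).
have lef : (msize f <= k)%N by rewrite /k -maxnA leq_maxl.
have leh : (msize h <= k)%N by rewrite /k leq_maxr.
rewrite /hfischer (fischerwE _ leh) (fischerwE _ lef) rmorph_sum /=.
apply: eq_bigr => m _; rewrite !mcoeff_map_mpoly !rmorphM /= conjC_nat.
by rewrite conjCK mulrAC.
Qed.

Lemma hfischer_ge0 f : 0 <= hfischer f f.
Proof.
apply: sumr_ge0 => m _; rewrite mcoeff_map_mpoly -mulrA mulr_ge0 ?ler0n //.
exact: mul_conjC_ge0.
Qed.

Lemma hfischer_eq0 f : hfischer f f = 0 -> f = 0.
Proof.
move=> /eqP; rewrite /hfischer /fischer psumr_eq0 => [/allP f0|m _].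
  apply/mpolyP => m; rewrite mcoeff0.
  case: (boolP (m \in msupp f)) => [mf|/memN_msupp_eq0 //].
  have := f0 m mf; rewrite mcoeff_map_mpoly -mulrA mulf_eq0 mul_conjC_eq0.
  rewrite pnatr_eq0 (negPf (lt0n_neq0 _)) ?prodn_gt0 // => [/eqP //|i].
  exact: fact_gt0.
rewrite mcoeff_map_mpoly -mulrA mulr_ge0 ?ler0n //; exact: mul_conjC_ge0.
Qed.

Lemma hfischer_lin_subst (L : 'M_N) f h :
  hfischer (lin_subst L f) h = hfischer f (lin_subst (map_mx Num.conj L^T) h).
Proof.
rewrite /hfischer fischer_lin_subst; congr fischer.
elim/mpoly_alg_ind: h => [c|i|h1 h2 IH1 IH2|h1 h2 IH1 IH2].
- by rewrite /lin_subst map_mpolyC !comp_mpolyC map_mpolyC.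
- rewrite /lin_subst map_mpolyX !comp_mpolyXU -!tnth_nth !tnth_mktuple.
  rewrite rmorph_sum /=; apply: eq_bigr => j _.
  by rewrite map_mpolyZ map_mpolyX !mxE /= conjCK.
- by rewrite raddfD /lin_subst !comp_mpolyD raddfD /=; congr (_ + _).
- by rewrite rmorphM /lin_subst !rmorphM /=; congr (_ * _).
Qed.

End Hermitian.

(** * Right translation of polynomials on matrices *)

Section RightTranslation.
Variables (F : numClosedFieldType) (n : nat).
Implicit Types (g x : 'M[F]_n) (f h : {mpoly F[n * n]}).

Definition rtrans g f := lin_subst (lin_mx (mulmxr g)) f.

Lemma mxeval_rtrans g f x : mxeval (rtrans g f) x = mxeval f (x *m g).
Proof. by rewrite /mxeval lin_subst_eval mul_vec_lin. Qed.

Lemma lin_mx_mulmxrE g (i j i' j' : 'I_n) :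
  lin_mx (mulmxr g) (mxvec_index i j) (mxvec_index i' j') = (i == i')%:R * g j j'.
Proof.
rewrite /lin_mx mxE /= vec_mx_delta mxvecE mxE (bigD1 j) //= mxE !eqxx /=.
by rewrite big1 ?addr0 1?eq_sym ?andbT // => k ne; rewrite mxE (negPf ne) andbF mul0r.
Qed.

Lemma rtransM g1 g2 f : rtrans (g1 *m g2) f = rtrans g1 (rtrans g2 f).
Proof. by apply: mxeval_inj => x; rewrite !mxeval_rtrans mulmxA. Qed.

Lemma rtrans1 f : rtrans 1%:M f = f.
Proof. by apply: mxeval_inj => x; rewrite mxeval_rtrans mulmx1. Qed.

Lemma lin_mx_mulmxr_trC g :
  map_mx Num.conj (lin_mx (mulmxr g))^T =
  lin_mx (mulmxr (map_mx Num.conj g^T)) :> 'M[F]_(n * n).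
Proof.
apply/matrixP => k l; case/mxvec_indexP: k => i j; case/mxvec_indexP: l => i' j'.
by rewrite [LHS]mxE [_^T _ _]mxE !lin_mx_mulmxrE !mxE rmorphM /= conjC_nat eq_sym.
Qed.

Lemma hfischer_rtrans g f h :
  hfischer (rtrans g f) h = hfischer f (rtrans (map_mx Num.conj g^T) h).
Proof. by rewrite hfischer_lin_subst lin_mx_mulmxr_trC. Qed.

Lemma polyfun_mxeval f : polyfun (mxeval f).
Proof. by exists f. Qed.

End RightTranslation.

(** * Orthogonality and complete reducibility *)

Lemma nat_max (A : nat -> Prop) b : (exists k, A k) -> (forall k, A k -> k <= b)%N ->
  exists2 k, A k & (forall j, A j -> j <= k)%N.
Proof.
elim: b => [|b IHb] [k0 Ak0] leb.
  exists 0%N; first by have := leb _ Ak0; rewrite leqn0 => /eqP <-.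
  exact: leb.
have [Ab|nAb] := classic (A b.+1); first by exists b.+1.
apply: IHb; first by exists k0.
move=> k Ak; have := leb k Ak; rewrite leq_eqVlt => /orP[/eqP eqk|//].
by case: nAb; rewrite -eqk.
Qed.

(** Among the subspaces contained in A, one of maximal dimension is all of A. *)
Lemma vspace_of_closed (F : fieldType) (V : vectType F) (A : V -> Prop) :
  A 0 -> (forall c u v, A u -> A v -> A (c *: u + v)) ->
  exists U : {vspace V}, forall v, v \in U <-> A v.
Proof.
move=> A0 Alin.
pose Q d := exists2 U : {vspace V}, \dim U = d & forall v, v \in U -> A v.
have [| |d [U dU AU] maxU] := @nat_max Q (\dim {:V}).
- by exists 0%N, 0%VS; [rewrite dimv0 | move=> v; rewrite memv0 => /eqP->].
- by move=> k [U <- _]; rewrite dimvS // subvf.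
exists U => v; split=> [/AU //|Av].
have /maxU : Q (\dim (<[v]> + U)).
  exists (<[v]> + U)%VS => // _ /memv_addP[_ /vlineP[c ->] [u /AU Au ->]].
  exact: Alin.
rewrite -dU => le_dim; have : (U == <[v]> + U)%VS by rewrite eqEdim addvSr.
by move=> /eqP->; apply: (subvP (addvSl _ _)); apply: memv_line.
Qed.

Section InvariantForm.
Variables (F : numClosedFieldType) (n : nat) (V : vectType F).
Variable a : 'M[F]_n -> 'End(V).
Hypothesis act_a : is_action a.

Lemma act1 v : a 1%:M v = v.
Proof. by case: act_a => -> _; rewrite id_lfunE. Qed.

Lemma actM g h v : g \in unitmx -> h \in unitmx -> a (g *m h) v = a g (a h v).
Proof. by case: act_a => _ aM ug uh; rewrite aM // comp_lfunE. Qed.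

Lemma trC_unitmx (g : 'M[F]_n) : g \in unitmx -> map_mx Num.conj g^T \in unitmx.
Proof. by move=> ug; rewrite map_unitmx unitmx_tr. Qed.

Definition is_inv_form (h : V -> V -> F) : Prop :=
  [/\ forall c u v w, h (c *: u + v) w = c * h u w + h v w,
      forall u w, h w u = (h u w)^*,
      forall u, h u u = 0 -> u = 0
    & forall g u w, g \in unitmx -> h (a g u) w = h u (a (map_mx Num.conj g^T) w)].

Section Polynomial.
Hypothesis pol_a : is_polynomial_action a.

Lemma act_polyfun (psi : {linear V -> F | *%R}) v :
  exists P, forall g, g \in unitmx -> psi (a g v) = mxeval P g.
Proof.
case: pol_a => P PE; pose e := vbasis {:V}.
exists (\sum_j \sum_(i < \dim {:V}) (coord e j v * psi e`_i) *: P i j) => g ug.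
rewrite {1}(coord_vbasis (memvf v)) !linear_sum /=.
rewrite /mxeval raddf_sum /=; apply: eq_bigr => j _.
rewrite !linearZ /= {1}(coord_vbasis (memvf (a g e`_j))) linear_sum /=.
rewrite raddf_sum mulr_sumr /=; apply: eq_bigr => i _.
by rewrite mevalZ linearZ /= PE // -mulrA [psi _ * _]mulrC.
Qed.

(** A vector is determined by the polynomials g |-> coord_i (a g v), and the
    action becomes right translation on them; the Fischer form, for which
    g and its conjugate transpose are adjoint, is pulled back to the module. *)
Lemma exists_inv_form : exists h, is_inv_form h.
Proof.
case: pol_a => P PE; pose e := vbasis {:V}; pose d := \dim {:V}.
pose mc i v : {mpoly F[n * n]} := \sum_j coord e j v *: P i j.
have mcE i v g : g \in unitmx -> mxeval (mc i v) g = coord e i (a g v).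
  move=> ug; rewrite /mxeval /mc raddf_sum /= {2}(coord_vbasis (memvf v)).
  rewrite !linear_sum /=; apply: eq_bigr => j _.
  by rewrite mevalZ !linearZ /= PE.
have mc_lin i c u v : mc i (c *: u + v) = c *: mc i u + mc i v.
  rewrite /mc scaler_sumr -big_split /=; apply: eq_bigr => j _.
  by rewrite linearD linearZ /= scalerDl scalerA.
have mc_act i g v : g \in unitmx -> mc i (a g v) = rtrans g (mc i v).
  move=> ug; apply: mxeval_inj; apply: polyfun_unit_eq => [||x ux].
  - exact: polyfun_mxeval.
  - exact: polyfun_mxeval.
  by rewrite mxeval_rtrans !mcE ?unitmx_mul ?ux // actM.
exists (fun u w => \sum_i hfischer (mc i u) (mc i w)); split.
- move=> c u v w; rewrite mulr_sumr -big_split /=; apply: eq_bigr => i _.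
  by rewrite mc_lin hfischerDl hfischerZl.
- by move=> u w; rewrite rmorph_sum; apply: eq_bigr => i _; apply: hfischer_conj.
- move=> u /eqP; rewrite psumr_eq0 => [/allP u0|i _]; last exact: hfischer_ge0.
  rewrite (coord_vbasis (memvf u)) big1 // => i _.
  have /eqP/hfischer_eq0 mc0 := u0 i (mem_index_enum i).
  by rewrite -{1}[u]act1 -mcE ?unitmx1 // mc0 /mxeval meval0 scale0r.
- move=> g u w ug; apply: eq_bigr => i _.
  by rewrite !mc_act ?trC_unitmx // hfischer_rtrans.
Qed.

End Polynomial.

Section Orthogonal.
Variable h : V -> V -> F.
Hypothesis form_h : is_inv_form h.

Lemma formC u w : h w u = (h u w)^*. Proof. by case: form_h. Qed.
Lemma form_eq0 u : h u u = 0 -> u = 0. Proof. by case: form_h => _ _ + _; apply. Qed.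
Lemma form_act g u w :
  g \in unitmx -> h (a g u) w = h u (a (map_mx Num.conj g^T) w).
Proof. by case: form_h => _ _ _; apply. Qed.

Lemma form_linear w : linear_for *%R (h^~ w).
Proof. by case: form_h => lin _ _ _ c u v; apply: lin. Qed.

Definition pairing w u := h u w.

HB.instance Definition _ w :=
  GRing.isLinear.Build F V F _ (pairing w) (form_linear w).

Definition form_functional w : {linear V -> F | *%R} := pairing w.

Lemma form0l w : h 0 w = 0. Proof. exact: (linear0 (pairing w)). Qed.
Lemma formZl c u w : h (c *: u) w = c * h u w.
Proof. by rewrite -[LHS]/(pairing w _) linearZ. Qed.
Lemma formBl u v w : h (u - v) w = h u w - h v w.
Proof. exact: (linearB (pairing w)). Qed.
Lemma form_suml (I : Type) (r : seq I) (f : I -> V) w :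
  h (\sum_(i <- r) f i) w = \sum_(i <- r) h (f i) w.
Proof. exact: (linear_sum (pairing w)). Qed.

Lemma formZr c u w : h u (c *: w) = c^* * h u w.
Proof. by rewrite formC formZl rmorphM /= -formC. Qed.

Lemma form_sumr (I : Type) (r : seq I) (f : I -> V) u :
  h u (\sum_(i <- r) f i) = \sum_(i <- r) h u (f i).
Proof.
rewrite formC form_suml rmorph_sum /=.
by apply: eq_bigr => i _; rewrite -formC.
Qed.

Lemma formBr u v w : h u (v - w) = h u v - h u w.
Proof. by rewrite formC formBl rmorphB /= -!formC. Qed.

(** The form being definite, the Gram matrix of a basis of U is invertible. *)
Lemma form_riesz (U : {vspace V}) (psi : {linear V -> F | *%R}) :
  exists2 u, u \in U & forall x, x \in U -> psi x = h x u.
Proof.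
pose b := vbasis U; pose G := \matrix_(i < \dim U, j < \dim U) h b`_i b`_j.
have uG : G \in unitmx.
  rewrite -row_free_unit -kermx_eq0; apply/eqP/row_matrixP => k.
  rewrite row0; set x := row k _.
  have xG : x *m G = 0 by apply/sub_kermxP; apply: row_sub.
  pose v := \sum_i x 0 i *: b`_i.
  have vb (j : 'I_(\dim U)) : h v b`_j = 0.
    transitivity ((x *m G) 0 j); last by rewrite xG mxE.
    rewrite form_suml mxE; apply: eq_bigr => i _.
    by rewrite formZl [G i j]mxE.
  have v0 : v = 0.
    apply: form_eq0; rewrite {2}/v form_sumr big1 // => j _.
    by rewrite formZr vb mulr0.
  have /freeP fr := basis_free (vbasisP U).
  by apply/rowP => i; rewrite [RHS]mxE; apply: (fr (x 0) v0).
pose y := invmx G *m \col_i psi b`_i.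
exists (\sum_j (y j 0)^* *: b`_j) => [|x xU].
  by apply: memv_suml => j _; apply/memvZ/vbasis_mem/mem_nth; rewrite size_tuple.
rewrite (coord_vbasis xU) linear_sum form_suml /=.
apply: eq_bigr => i _; rewrite linearZ formZl /=; congr (_ * _).
have <- : (G *m y) i 0 = psi b`_i by rewrite /y mulKVmx // mxE.
rewrite form_sumr mxE; apply: eq_bigr => j _.
by rewrite formZr conjCK mxE mulrC.
Qed.

(** U' is the orthogonal complement of U in M: it is stable because the
    conjugate transpose of an invertible matrix is again invertible. *)
Lemma stable_complement (U M : {vspace V}) :
  (U <= M)%VS -> gl_stable a U -> gl_stable a M ->
  exists U' : {vspace V},
    [/\ gl_stable a U', (U + U')%VS = M & (U :&: U')%VS = 0%VS].
Proof.
move=> sUM stU stM.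
have [|c u v [uM u0] [vM v0]|U' U'E] :=
    @vspace_of_closed _ V (fun x => x \in M /\ forall u, u \in U -> h x u = 0).
- by split; [apply: mem0v | move=> u _; rewrite form0l].
- split=> [|w wU]; first by rewrite memvD ?memvZ.
  by rewrite form_linear u0 // v0 // mulr0 addr0.
exists U'; split.
- move=> g ug x /U'E[xM x0]; apply/U'E; split; first exact: stM.
  by move=> u uU; rewrite form_act // x0 // stU // trC_unitmx.
- apply/eqP; rewrite eqEsubv; apply/andP; split; apply/subvP => x.
    by move=> /memv_addP[u uU [w /U'E[wM _] ->]]; apply: memvD => //; apply: (subvP sUM).
  move=> xM; have [u uU uE] := form_riesz U (pairing x).
  rewrite -(subrK u x) addrC memv_add //; apply/U'E; split.
    by apply: memvB => //; apply: (subvP sUM).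
  by move=> y yU; rewrite formBl formC (formC y u) -[h y x]/(pairing x y) uE // subrr.
- apply/eqP; rewrite -subv0; apply/subvP => x /memv_capP[xU /U'E[_ x0]].
  by rewrite memv0; apply/eqP/form_eq0/x0.
Qed.

Lemma exists_irreducible (M : {vspace V}) : M != 0%VS -> gl_stable a M ->
  exists2 U : {vspace V}, gl_irreducible a U & (U <= M)%VS.
Proof.
have [k] := ubnP (\dim M); elim: k M => // k IHk M; rewrite ltnS => leMk M0 stM.
have [irrM|nirrM] := classic (forall U', (U' <= M)%VS -> gl_stable a U' ->
    U' = 0%VS \/ U' = M); first by exists M.
have [U' [sU' stU' U'0 neU']] : exists U' : {vspace V},
    [/\ (U' <= M)%VS, gl_stable a U', U' != 0%VS & U' <> M].
  apply: NNPP => nU; apply: nirrM => U' sU' stU'; apply: NNPP => /not_or_and[U'0 neU'].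
  by apply: nU; exists U'; split=> //; apply/eqP.
have [|//|//|U irrU sU] := IHk U'; last by exists U => //; apply: subv_trans sU'.
apply: leq_trans leMk; rewrite ltn_neqAle dimvS // andbT.
by apply/negP => dimE; apply: neU'; apply/eqP; rewrite eqEdim sU' (eqP dimE) /=.
Qed.

End Orthogonal.
End InvariantForm.

(** * Highest weight vectors *)

Section Torus.
Variables (F : numClosedFieldType) (n : nat).
Implicit Types t : 'rV[F]_n.

Definition tpow t (mu : 'X_{1..n}) : F := \prod_i t 0 i ^+ mu i.

Lemma diag_unitmx t : (forall i, t 0 i != 0) -> diag_mx t \in unitmx.
Proof.
move=> t_neq0; rewrite unitmxE unitfE det_diag.
by apply/prodf_neq0 => i _.
Qed.

(** Distinct characters of the torus are linearly independent. *)
Lemma tpow_indep (W : vectType F) k (y : 'X_{1..n < k} -> W) :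
  (forall t, (forall i, t 0 i != 0) -> \sum_(mu : 'X_{1..n < k}) tpow t mu *: y mu = 0) ->
  forall mu, y mu = 0.
Proof.
move=> y0 mu; rewrite (coord_vbasis (memvf (y mu))) big1 // => i _.
set e := vbasis _.
pose Q : {mpoly F[n]} := \sum_(nu : 'X_{1..n < k}) coord e i (y nu) *: 'X_[nu].
have Q0 : Q = 0.
  apply: mpoly_eq0_torus => x x_neq0; pose t := \row_j x j.
  have tE j : t 0 j = x j by rewrite mxE.
  have t_neq0 j : t 0 j != 0 by rewrite tE.
  have := congr1 (coord e i) (y0 t t_neq0); rewrite linear0 linear_sum => <-.
  rewrite raddf_sum; apply: eq_bigr => nu _; rewrite linearZ /= mevalZ mevalX mulrC.
  by congr (_ * _); apply: eq_bigr => j _; rewrite tE.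
have := congr1 (fun q : {mpoly F[n]} => q@_mu) Q0; rewrite mcoeff0 raddf_sum /=.
rewrite (bigD1 mu) //= mcoeffZ mcoeffX eqxx mulr1 big1 ?addr0 => [->|nu ne].
  by rewrite scale0r.
by rewrite mcoeffZ mcoeffX -bmeqP (negPf ne) mulr0.
Qed.

End Torus.

Section HighestWeight.
Variables (F : numClosedFieldType) (n : nat) (V : vectType F).
Variable a : 'M[F]_n -> 'End(V).
Hypotheses (act_a : is_action a) (pol_a : is_polynomial_action a).
Implicit Types (t : 'rV[F]_n) (M U : {vspace V}).

Definition is_weight (v : V) (mu : 'X_{1..n}) :=
  forall t, (forall i, t 0 i != 0) -> a (diag_mx t) v = tpow t mu *: v.

(** The matrix entries of a (diag_mx t) are polynomials in t; the bound k on their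
    degrees serves all vectors x. *)
Lemma torus_expansion : exists k, forall x : V,
  exists y : 'X_{1..n < k} -> V, forall t, (forall i, t 0 i != 0) ->
    a (diag_mx t) x = \sum_(mu : 'X_{1..n < k}) tpow t mu *: y mu.
Proof.
case: pol_a => P PE; pose e := vbasis {:V}; pose d := \dim {:V}.
pose D : (n * n).-tuple {mpoly F[n]} :=
  [tuple mxvec (diag_mx (\row_i 'X_i : 'rV[{mpoly F[n]}]_n)) 0 k | k < n * n].
pose Q i j := P i j \mPo D.
pose k := (\max_(ij : 'I_d * 'I_d) msize (Q ij.1 ij.2))%N; exists k => x.
exists (fun mu => \sum_i (\sum_j coord e j x * (Q i j)@_mu) *: e`_i) => t t_neq0.
have QE (i j : 'I_d) : coord e i (a (diag_mx t) e`_j) = \sum_(mu : 'X_{1..n < k}) tpow t mu * (Q i j)@_mu.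
  rewrite PE ?diag_unitmx //; transitivity (Q i j).@[t 0].
    rewrite comp_mpoly_meval; apply: meval_eq => l; rewrite tnth_mktuple.
    case/mxvec_indexP: l => l m; rewrite !mxvecE !mxE.
    by case: eqP => [->|_]; rewrite ?mulr1n ?mulr0n ?meval0 ?mevalXU.
  have leQ : (msize (Q i j) <= k)%N by apply: (leq_bigmax (i, j)).
  rewrite {1}(mpolywE leQ) raddf_sum /=; apply: eq_bigr => mu _.
  by rewrite mevalZ mevalX mulrC.
rewrite {1}(coord_vbasis (memvf x)) linear_sum /=.
rewrite (coord_vbasis (memvf (\sum_j _))).
under [RHS]eq_bigr do rewrite scaler_sumr.
rewrite exchange_big /=; apply: eq_bigr => i _.
rewrite -/e; under [RHS]eq_bigr do rewrite scalerA.
rewrite -scaler_suml; congr (_ *: _).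
rewrite linear_sum /=; under eq_bigr do rewrite !linearZ /= QE.
under [RHS]eq_bigr do rewrite mulr_sumr; rewrite exchange_big /=.
apply: eq_bigr => j _; rewrite mulr_sumr; apply: eq_bigr => mu _.
by rewrite mulrCA.
Qed.

Lemma weight_components M x k (y : 'X_{1..n < k} -> V) :
    gl_stable a M -> x \in M ->
    (forall t, (forall i, t 0 i != 0) ->
      a (diag_mx t) x = \sum_(mu : 'X_{1..n < k}) tpow t mu *: y mu) ->
  [/\ x = \sum_mu y mu, forall mu, y mu \in M & forall mu, is_weight (y mu) mu].
Proof.
move=> stM xM yE; split.
- have := yE (const_mx 1); rewrite diag_const_mx act1 // => -> => [|i].
    by apply: eq_bigr => mu _; rewrite /tpow big1 ?scale1r // => i _; rewrite mxE expr1n.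
  by rewrite mxE oner_neq0.
- move=> mu; suffices : y mu - projv M (y mu) = 0.
    by move/eqP; rewrite subr_eq0 => /eqP->; apply: memv_proj.
  move: mu; apply: tpow_indep => t t_neq0.
  under eq_bigr do rewrite scalerBr -linearZ /=.
  rewrite big_split /= sumrN -(linear_sum (projv M)) -yE //= projv_id ?subrr //.
  exact/stM/xM/diag_unitmx.
- move=> mu s s_neq0; apply/eqP; rewrite -subr_eq0; apply/eqP.
  move: mu; apply: tpow_indep => t t_neq0.
  under eq_bigr do rewrite scalerBr -linearZ /= scalerA.
  rewrite big_split /= sumrN -(linear_sum (a _)) -yE //= -actM ?diag_unitmx // mulmx_diag.
  rewrite yE => [|i]; last by rewrite mxE mulf_neq0.
  rewrite -sumrB big1 // => mu _; rewrite -scalerBl.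
  have -> : tpow (\row_j (s 0 j * t 0 j)) mu = tpow t mu * tpow s mu.
    rewrite /tpow -big_split; apply: eq_bigr => i _.
    by rewrite mxE exprMn mulrC.
  by rewrite subrr scale0r.
Qed.

Lemma weight_bound : exists k, forall v mu, v != 0 -> is_weight v mu -> (mdeg mu < k)%N.
Proof.
have [k kE] := torus_expansion; exists k => v mu v_neq0 wv.
rewrite ltnNge; apply: contra v_neq0 => le_k.
have [y yE] := kE v.
rewrite (coord_vbasis (memvf v)) big1 // => i _; set e := vbasis _.
pose Q : {mpoly F[n]} :=
  coord e i v *: 'X_[mu] - \sum_(nu : 'X_{1..n < k}) coord e i (y nu) *: 'X_[nu].
have Q0 : Q = 0.
  apply: mpoly_eq0_torus => x x_neq0; pose t := \row_j x j.
  have tE j : t 0 j = x j by rewrite mxE.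
  have t_neq0 j : t 0 j != 0 by rewrite tE.
  have tpowE nu : 'X_[nu].@[x] = tpow t nu.
    by rewrite mevalX; apply: eq_bigr => j _; rewrite tE.
  have := congr1 (coord e i) (yE t t_neq0); rewrite wv // linearZ linear_sum /=.
  move=> eq_c; rewrite /Q mevalB mevalZ tpowE mulrC eq_c (raddf_sum (meval x)) /= -sumrB.
  by rewrite big1 // => nu _; rewrite mevalZ tpowE linearZ /= mulrC subrr.
have := congr1 (fun q : {mpoly F[n]} => q@_mu) Q0.
rewrite mcoeff0 mcoeffB mcoeffZ mcoeffX eqxx mulr1 raddf_sum /= big1 ?subr0 => [->|nu _].
  by rewrite scale0r.
rewrite mcoeffZ mcoeffX; case: eqP => [eq_nu|]; last by rewrite mulr0.
by have := bmdeg nu; rewrite eq_nu ltnNge le_k.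
Qed.

(** The exponent of s in the value of the character mu at diag (s ^ n, ..., s). *)
Definition height (mu : 'X_{1..n}) := (\sum_(i < n) (n - i) * mu i)%N.

Definition conj_curve (g : 'M[F]_n) (s : F) : 'M[F]_n :=
  \matrix_(i, j) (g i j * s ^+ (j - i)).

Lemma upper_unitriangular_unit (g : 'M[F]_n) : upper_unitriangular g -> g \in unitmx.
Proof.
move=> gu; rewrite -unitmx_tr unitmxE unitfE det_trig.
  by apply/prodf_neq0 => i _; rewrite mxE gu // eqxx oner_neq0.
by apply/is_trig_mxP => i j ltij; rewrite mxE gu ?(ltnW ltij) // -val_eqE gtn_eqF.
Qed.

(** Let D = diag (s ^ n, ..., s).  Then conj_curve g s is the conjugate of g by D,
    it is polynomial in s and equals g at s = 1 and the identity at s = 0.  If v has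
    maximal height m, then s ^ m * a (conj_curve g s) v = a D (a g v) has no term of
    degree above m in s, so that a (conj_curve g s) v does not depend on s. *)
Lemma maximal_height_invariant M v mu (g : 'M[F]_n) :
    gl_stable a M -> v \in M -> is_weight v mu ->
    (forall w nu, w \in M -> w != 0 -> is_weight w nu -> (height nu <= height mu)%N) ->
  upper_unitriangular g -> a g v = v.
Proof.
move=> stM vM wv maxv gu; pose e := vbasis {:V}.
have curveU s : upper_unitriangular (conj_curve g s).
  by move=> i j leji; rewrite mxE gu // (eqP leji) expr0 mulr1.
have unit_g := upper_unitriangular_unit gu.
have [k kE] := torus_expansion; have [y yE] := kE (a g v).
have [_ yM wy] := weight_components stM (stM g unit_g v vM) yE.
suffices eqc i : coord e i (a g v) = coord e i v.
  rewrite (coord_vbasis (memvf (a g v))) [RHS](coord_vbasis (memvf v)).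
  by apply: eq_bigr => i _; rewrite eqc.
have [P PE] := act_polyfun pol_a (coord e i) v.
pose c l : {poly F} := mxvec (\matrix_(i, j) (g i j *: 'X^(j - i))) 0 l.
have [p pE] := mpoly_subst_poly P c.
have {PE pE} pE s : p.[s] = coord e i (a (conj_curve g s) v).
  rewrite PE ?upper_unitriangular_unit // -pE; apply: meval_eq => l.
  by case/mxvec_indexP: l => l m; rewrite /c !mxvecE !mxE hornerZ hornerXn.
pose q : {poly F} := \sum_(nu : 'X_{1..n < k}) coord e i (y nu) *: 'X^(height nu).
have pq : 'X^(height mu) * p = q.
  apply: poly_ext_neq0 => s s_neq0; pose t : 'rV[F]_n := \row_j s ^+ (n - j).
  have t_neq0 j : t 0 j != 0 by rewrite mxE expf_neq0.
  have tE nu : tpow t nu = s ^+ height nu.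
    by rewrite /height -prodrXr; apply: eq_bigr => j _; rewrite mxE exprM.
  have conjE : conj_curve g s *m diag_mx t = diag_mx t *m g.
    apply/matrixP => j l; rewrite mul_mx_diag mul_diag_mx !mxE.
    have [lejl|ltlj] := leqP j l; last first.
      by rewrite gu ?(ltnW ltlj) // -val_eqE gtn_eqF // !mul0r mulr0.
    rewrite -mulrA -exprD mulrC; congr (s ^+ _ * _).
    by rewrite addnC addnBA // subnK // ltnW.
  rewrite hornerM hornerXn pE -tE.
  transitivity (coord e i (a (conj_curve g s) (tpow t mu *: v))).
    by rewrite !linearZ.
  rewrite -wv // -actM ?diag_unitmx //; last first.
    exact: upper_unitriangular_unit.
  rewrite conjE actM ?diag_unitmx // yE // linear_sum horner_sum.
  by apply: eq_bigr => nu _; rewrite linearZ hornerZ hornerXn /= tE mulrC.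
have p_const : p = (p`_0)%:P.
  apply/polyP => -[|l]; rewrite coefC //=.
  have -> : p`_l.+1 = ('X^(height mu) * p)`_(height mu + l.+1).
    by rewrite coefXnM ltnNge leq_addr /= addKn.
  rewrite pq coef_sum big1 // => nu _; rewrite coefZ coefXn.
  have [->|y_neq0] := eqVneq (y nu) 0; first by rewrite linear0 mul0r.
  rewrite gtn_eqF ?mulr0 //.
  by apply: leq_ltn_trans (maxv _ _ (yM nu) y_neq0 (wy nu)) _; rewrite addnS ltnS leq_addr.
have c1 : conj_curve g 1 = g by apply/matrixP => j l; rewrite mxE expr1n mulr1.
have c0 : conj_curve g 0 = 1%:M.
  apply/matrixP => j l; rewrite !mxE expr0n subn_eq0.
  have [lelj|ltjl] := leqP l j; first by rewrite gu // mulr1.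
  by rewrite mulr0 -val_eqE ltn_eqF.
by rewrite -{1}c1 -pE p_const hornerC -(hornerC p`_0 0) -p_const pE c0 act1.
Qed.

(** A transposition matrix exchanges lam_i and lam_j in the weight, and for i < j
    this increases the height if lam_i < lam_j. *)
Lemma maximal_height_partition M v mu :
    gl_stable a M -> v \in M -> v != 0 -> is_weight v mu ->
    (forall w nu, w \in M -> w != 0 -> is_weight w nu -> (height nu <= height mu)%N) ->
  is_partition mu.
Proof.
move=> stM vM v_neq0 wv maxv i j leij.
have [->//|neij] := eqVneq i j.
have ltij : (i < j)%N by rewrite ltn_neqAle leij val_eqE neij.
pose w : 'M[F]_n := tperm_mx i j; pose nu := [multinom mu (tperm i j l) | l < n].
have uw : w \in unitmx by apply: unitmx_perm.
have : (height nu <= height mu)%N.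
  apply: (maxv (a w v)) => [||t t_neq0]; first exact: stM.
    apply: contra v_neq0 => /eqP av0; rewrite -[v](act1 act_a) -(mulVmx uw).
    by rewrite actM ?unitmx_inv // av0 linear0.
  pose t' := \row_l t 0 (tperm i j l).
  have t'_neq0 l : t' 0 l != 0 by rewrite mxE.
  have wE : diag_mx t *m w = w *m diag_mx t'.
    apply/matrixP => l m; rewrite mul_diag_mx mul_mx_diag !mxE.
    by case: eqP => [<-|_]; rewrite ?tpermK ?mulr1 ?mul1r ?mulr0 ?mul0r.
  rewrite -actM ?diag_unitmx // wE actM ?diag_unitmx // wv // linearZ /=.
  congr (_ *: _); rewrite /tpow (reindex_inj (@perm_inj _ (tperm i j))) /=.
  by apply: eq_bigr => l _; rewrite mxE tpermK mnmE.
have bigE (m : 'X_{1..n}) : height m = ((n - i) * m i + ((n - j) * m j +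
    \sum_(l | (l != i) && (l != j)) (n - l) * m l))%N.
  by rewrite /height (bigD1 i) //= (bigD1 j) //= eq_sym.
rewrite !bigE !mnmE tpermL tpermR.
have -> : (\sum_(l < n | (l != i) && (l != j)) (n - l) * nu l =
    \sum_(l < n | (l != i) && (l != j)) (n - l) * mu l)%N.
  by apply: eq_bigr => l /andP[li lj]; rewrite mnmE tpermD // eq_sym.
rewrite !addnA leq_add2r; have ltjn := ltn_ord j.
have -> : (n - i = (n - j) + (j - i))%N by rewrite addnBA ?subnK // ltnW.
rewrite !mulnDl addnAC [leqRHS]addnAC [((n - j) * mu i + _)%N]addnC leq_add2l.
by rewrite leq_pmul2l // subn_gt0.
Qed.

Lemma exists_highest_weight M : M != 0%VS -> gl_stable a M ->
  exists2 lam, is_partition lam & has_highest_weight a M lam.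
Proof.
move=> M_neq0 stM.
pose A d := exists mu v, [/\ v \in M, v != 0, is_weight v mu & height mu = d].
have [k kbound] := weight_bound.
have [| |d [mu [v [vM v_neq0 wv hmu]]] maxd] := @nat_max A (n * k).
- have [m mE] := torus_expansion; have [y yE] := mE (vpick M).
  have [xE yM wy] := weight_components stM (memv_pick M) yE.
  have [nu y_neq0] : exists nu, y nu != 0.
    apply/existsP; apply: contraR M_neq0; rewrite negb_exists => /forallP y0.
    rewrite -vpick0 xE big1 // => nu _; apply/eqP/negPn/y0.
  by exists (height nu), nu, (y nu).
- move=> d [mu [v [vM v_neq0 wv <-]]].
  apply: leq_trans (_ : n * mdeg mu <= _)%N; last first.
    by rewrite leq_mul2l (ltnW (kbound _ _ v_neq0 wv)) orbT.
  rewrite mdegE big_distrr /=; apply: leq_sum => i _.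
  by rewrite leq_mul2r leq_subr orbT.
have maxv w nu : w \in M -> w != 0 -> is_weight w nu -> (height nu <= height mu)%N.
  by move=> wM w_neq0 ww; rewrite hmu; apply: maxd; exists nu, w.
exists mu; first exact: (maximal_height_partition stM vM v_neq0 wv maxv).
exists v; split=> // g gu; exact: (maximal_height_invariant stM vM wv maxv gu).
Qed.

Lemma exists_decomposition : exists s, is_decomposition a s.
Proof.
have [h form_h] := exists_inv_form act_a pol_a.
suffices dec : forall M, gl_stable a M -> exists ss : seq ({vspace V} * 'X_{1..n}),
    [/\ (\sum_(p <- ss) p.1)%VS = M, \dim M = (\sum_(p <- ss) \dim p.1)%N
      & forall p, p \in ss ->
        [/\ gl_irreducible a p.1, is_partition p.2 & has_highest_weight a p.1 p.2]].
  have [|ss [sumE dimE good]] := dec fullv; first by move=> g _ u _; apply: memvf.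
  exists [seq p.2 | p <- ss].
  have lt_size (i : 'I_(size [seq p.2 | p <- ss])) : (i < size ss)%N.
    by rewrite -(size_map snd).
  pose U (i : 'I_(size [seq p.2 | p <- ss])) := (nth (0%VS, 0%MM) ss i).1.
  have reix (R : Type) (idx : R) (op : Monoid.com_law idx) (f : {vspace V} -> R) :
      \big[op/idx]_(p <- ss) f p.1 = \big[op/idx]_i f (U i).
    by rewrite (big_nth (0%VS, 0%MM)) -(size_map snd ss) big_mkord.
  exists U; split.
  - apply/directvP => /=; rewrite -(reix _ _ _ id) -(reix _ _ _ (fun W => \dim W)).
    by rewrite sumE.
  - by rewrite -(reix _ _ _ id).
  - move=> i; have := good _ (mem_nth (0%VS, 0%MM) (lt_size i)).
    by rewrite (tnth_nth 0%MM) /= (nth_map (0%VS, 0%MM)).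
move=> M; have [k] := ubnP (\dim M); elim: k M => // k IHk M; rewrite ltnS => leMk stM.
have [->|M_neq0] := eqVneq M 0%VS.
  by exists [::]; split; rewrite ?big_nil ?dimv0.
have [U irrU sUM] := exists_irreducible M_neq0 stM.
have [U_neq0 stU _] := irrU.
have [U' [stU' sumE capE]] := stable_complement form_h sUM stU stM.
have dimE : \dim M = (\dim U + \dim U')%N.
  by rewrite -dimv_sum_cap sumE capE dimv0 addn0.
have [|//|ss [ssE ssdim good]] := IHk U'.
  by apply: leq_trans leMk; rewrite dimE -addn1 addnC leq_add2r lt0n dimv_eq0.
have [lam plam hw] := exists_highest_weight U_neq0 stU.
exists ((U, lam) :: ss); split; rewrite ?big_cons ?ssE -?ssdim //.
by move=> p; rewrite inE => /predU1P[->|/good].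
Qed.

End HighestWeight.

(** * Substitution actions on homogeneous polynomials *)

Section Homogeneous.
Variables (F : numFieldType) (N : nat).
Implicit Types (P : {mpoly F[N]}) (L : 'M[F]_N).

Lemma meval_scale_homog l P c (y : 'rV_N) :
  P \is l.-homog -> P.@[(c *: y) 0] = c ^+ l * P.@[y 0].
Proof.
move=> hP; rewrite !mevalE mulr_sumr big_seq [RHS]big_seq.
apply: eq_bigr => m mP; rewrite mulrCA; congr (_ * _).
rewrite -(dhomog_mf hP mP) /= mdegE -prodrXr -big_split /=.
by apply: eq_bigr => i _; rewrite mxE exprMn.
Qed.

(** In characteristic 0 the powers of 2 are distinct, so scaling the variables by 2
    detects the degree. *)
Lemma homog_meval_scale l P :
  (forall y : 'rV_N, P.@[(2%:R *: y) 0] = 2%:R ^+ l * P.@[y 0]) -> P \is l.-homog.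
Proof.
move=> P2; apply/dhomogP => m mP.
pose Q : {mpoly F[N]} :=
  \sum_(k <- msupp P) ((2%:R ^+ mdeg k - 2%:R ^+ l) * P@_k) *: 'X_[k].
have Q0 : Q = 0.
  apply: mpoly_ext => y; rewrite meval0 raddf_sum /=.
  have /eqP := P2 y; rewrite -subr_eq0 !mevalE mulr_sumr -sumrB => /eqP sum0; rewrite -[RHS]sum0.
  apply: eq_bigr => k _; rewrite mevalZ mevalX -[LHS]mulrA mulrBl.
  congr (_ - _); rewrite [LHS]mulrCA; congr (_ * _).
  rewrite mdegE -prodrXr -big_split; apply: eq_bigr => i _.
  by rewrite mxE exprMn.
have := congr1 (fun q : {mpoly F[N]} => q@_m) Q0; rewrite mcoeff0 raddf_sum /=.
rewrite (bigD1_seq m) ?msupp_uniq //= mcoeffZ mcoeffX eqxx mulr1.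
rewrite big1 ?addr0 => [/eqP|k ne]; last by rewrite mcoeffZ mcoeffX (negPf ne) mulr0.
rewrite mulf_eq0 mcoeff_eq0 mP orbF subr_eq0 -!natrX eqr_nat.
by rewrite eqn_exp2l // => /eqP.
Qed.

Lemma lin_subst_homog l L P : P \is l.-homog -> lin_subst L P \is l.-homog.
Proof.
move=> hP; apply: homog_meval_scale => y.
by rewrite !lin_subst_eval -scalemxAl (meval_scale_homog _ _ hP).
Qed.

End Homogeneous.

Section SubstitutionAction.
Variables (F : numClosedFieldType) (n d l : nat).
Variable L L' : 'M[F]_n -> 'M[F]_d.
Variable A : 'M[F]_n -> 'End(symPow F d l).
Hypothesis AE : forall g f, val (A g f) = lin_subst (L g) (val f).

Lemma subst_is_action :
  (forall f, lin_subst (L 1%:M) f = f) ->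
  {in unitmx &, forall g h f, lin_subst (L (g *m h)) f = lin_subst (L g) (lin_subst (L h) f)} ->
  is_action A.
Proof.
move=> L1 LM; split=> [|g h ug uh]; apply/lfunP => f; apply: val_inj.
  by rewrite AE L1 id_lfunE.
by rewrite comp_lfunE !AE LM.
Qed.

Lemma polyfun_mcoeff_lin_subst f m :
  (forall i j, polyfun (fun g => L' g i j)) ->
  polyfun (fun g => (lin_subst (L' g) f)@_m).
Proof.
move=> pL; elim/mpoly_alg_ind: f m => [c|i|f1 f2 IH1 IH2|f1 f2 IH1 IH2] m.
- apply: eq_polyfun (polyfun_const _ (c%:MP_[d])@_m) => g.
  by rewrite /lin_subst comp_mpolyC.
- apply: (@eq_polyfun _ _ (fun g => \sum_j L' g j i * ('X_j : {mpoly F[d]})@_m)).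
    move=> g; rewrite /lin_subst comp_mpolyXU -tnth_nth tnth_mktuple raddf_sum /=.
    by apply: eq_bigr => j _; rewrite mcoeffZ.
  by apply: polyfun_sum => j _; apply: polyfunM => //; apply: polyfun_const.
- apply: eq_polyfun (polyfunD (IH1 m) (IH2 m)) => g.
  by rewrite /lin_subst comp_mpolyD mcoeffD.
- apply: (@eq_polyfun _ _ (fun g => \sum_(k : 'X_{1..d < (mdeg m).+1, (mdeg m).+1}
      | m == (k.1 + k.2)%MM) (lin_subst (L' g) f1)@_k.1 * (lin_subst (L' g) f2)@_k.2)).
    by move=> g; rewrite /lin_subst rmorphM /= mcoeffM.
  by apply: polyfun_sum => k _; apply: polyfunM.
Qed.

Lemma symPow_functional (psi : {linear symPow F d l -> F | *%R}) :
  exists c : 'X_{1..d < l.+1} -> F, forall f, psi f = \sum_(m : 'X_{1..d < l.+1}) (val f)@_m * c m.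
Proof.
pose X (m : 'X_{1..d < l.+1}) : symPow F d l := insubd (0 : symPow F d l) 'X_[m].
exists (fun m => psi (X m)) => f.
have le_f : (msize (val f) <= l.+1)%N.
  rewrite msizeE; apply/bigmax_leqP_seq => m mf _.
  by rewrite (dhomog_mf (dhomog_is_dhomog f) mf).
have {1}-> : f = \sum_(m : 'X_{1..d < l.+1}) (val f)@_m *: X m.
  apply: val_inj; rewrite {1}(mpolywE le_f) [RHS]raddf_sum /=.
  apply: eq_bigr => m _; transitivity ((val f)@_m *: val (X m)); last by [].
  have [mf|/memN_msupp_eq0->] := boolP ((m : 'X_{1..d}) \in msupp (val f)); last by rewrite !scale0r.
  rewrite insubdK // -topredE /= dhomogX /=.
  by rewrite (dhomog_mf (dhomog_is_dhomog f) mf).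
by rewrite linear_sum; apply: eq_bigr => m _; rewrite linearZ.
Qed.

(** Nothing is known on the values of an action outside invertible matrices, hence
    the polynomial matrix L' besides L. *)
Lemma subst_is_polynomial_action :
  {in unitmx, L =1 L'} -> (forall i j, polyfun (fun g => L' g i j)) ->
  is_polynomial_action A.
Proof.
move=> eqL pL; rewrite /is_polynomial_action; set e := vbasis _.
suffices PE i j : exists P, forall g, g \in unitmx ->
    coord e i (A g e`_j) = mxeval P g.
  have /fin_all_exists[P PP] i := fin_all_exists (fun j : 'I_(\dim {:symPow F d l}) => PE i j).
  by exists P => g ug i j; apply: PP.
have [c cE] := symPow_functional (coord e i).
have [P PE] : polyfun (fun g => \sum_(m : 'X_{1..d < l.+1}) (lin_subst (L' g) (val e`_j))@_m * c m).
  apply: polyfun_sum => m _; apply: polyfunM; last exact: polyfun_const.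
  exact: polyfun_mcoeff_lin_subst.
exists P => g ug; rewrite -PE cE; apply: eq_bigr => m _.
by rewrite AE eqL.
Qed.

End SubstitutionAction.

Section SymmetricPower.
Variables (F : numClosedFieldType) (n : nat) (V : vectType F).
Variable a : 'M[F]_n -> 'End(V).
Hypotheses (act_a : is_action a) (pol_a : is_polynomial_action a).
Variable l : nat.

Let d := \dim {:V}.
Let L g : 'M[F]_d := \matrix_(j, i) coord (vbasis {:V}) j (a g (vbasis {:V})`_i).

Let sym_actE g f : val (sym_act a l g f) = lin_subst (L g) (val f).
Proof.
rewrite Defs.sym_actE; congr (_ \mPo _); apply: eq_from_tnth => i.
by rewrite !tnth_mktuple; apply: eq_bigr => j _; rewrite mxE.
Qed.

Lemma sym_act_is_action : is_action (sym_act a l).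
Proof.
apply: (subst_is_action sym_actE) => [f|g h ug uh f].
  have -> : L 1%:M = 1%:M; last exact: lin_subst1.
  apply/matrixP => j i; rewrite [LHS]mxE [RHS]mxE (act1 act_a) eq_sym.
  by apply: coord_free; apply: (basis_free (vbasisP _)).
rewrite -lin_substM; congr (lin_subst _ f); apply/matrixP => j i; rewrite !mxE actM //.
rewrite {1}(coord_vbasis (memvf (a h _))) !linear_sum /=; apply: eq_bigr => k _.
by rewrite !linearZ /= !mxE mulrC.
Qed.

Lemma sym_act_is_polynomial : is_polynomial_action (sym_act a l).
Proof.
have [P PE] := pol_a.
apply: (subst_is_polynomial_action (L' := fun g => \matrix_(j, i) mxeval (P j i) g) sym_actE).
  by move=> g ug; apply/matrixP => j i; rewrite !mxE PE.
move=> j i; apply: eq_polyfun (polyfun_mxeval (P j i)) => g; by rewrite mxE.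
Qed.

End SymmetricPower.

Section RightTranslationAction.
Variables (F : numClosedFieldType) (n l : nat).

Definition rtrans_fun (g : 'M[F]_n) (f : symPow F (n * n) l) : symPow F (n * n) l :=
  DHomog (lin_subst_homog (lin_mx (mulmxr g)) (dhomog_is_dhomog f)).

Definition rtrans_act g : 'End(symPow F (n * n) l) := linfun (rtrans_fun g).

Lemma rtrans_actE g f : val (rtrans_act g f) = rtrans g (val f).
Proof.
have lin : linear (rtrans_fun g).
  by move=> c p q; apply/val_inj; rewrite /= /lin_subst comp_mpolyD comp_mpolyZ.
pose T := HB.pack_for {linear symPow F (n * n) l -> symPow F (n * n) l}
  (rtrans_fun g) (GRing.isLinear.Build _ _ _ _ _ lin).
by rewrite /rtrans_act (lfunE T).
Qed.

Lemma rtrans_is_action : is_action rtrans_act.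
Proof.
apply: (subst_is_action rtrans_actE) => [f|g h ug uh f]; first exact: rtrans1.
exact: rtransM.
Qed.

Lemma rtrans_is_polynomial : is_polynomial_action rtrans_act.
Proof.
apply: (subst_is_polynomial_action rtrans_actE) => // k m.
case/mxvec_indexP: k => i j; case/mxvec_indexP: m => i' j'.
apply: (@eq_polyfun _ _ (fun g => (i == i')%:R * g j j')) => [g|].
  by rewrite lin_mx_mulmxrE.
by apply: polyfunM; [apply: polyfun_const | apply: polyfun_entry].
Qed.

End RightTranslationAction.

(** * Triangular factorizations *)

Section Factorization.
Variable F : numClosedFieldType.

(** The leading block of size i of A, padded with entries of C to the size of A:
    for C = 1%:M its determinant is a leading principal minor of A. *)
Definition trunc n (C : 'M[F]_n) (i : nat) (A : 'M[F]_n) : 'M[F]_n :=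
  \matrix_(j, k) if (j < i)%N && (k < i)%N then A j k else C j k.

Lemma trunc_full n (C A : 'M[F]_n) : trunc C n A = A.
Proof. by apply/matrixP => j k; rewrite mxE !ltn_ord. Qed.

Lemma trunc0 n (C A : 'M[F]_n) : trunc C 0 A = C.
Proof. by apply/matrixP => j k; rewrite mxE. Qed.

Lemma trunc_id n (C : 'M[F]_n) i : trunc C i C = C.
Proof. by apply/matrixP => j k; rewrite mxE if_same. Qed.

Lemma trunc_block m r (C1 : 'M[F]_m) (C2 : 'M[F]_r) i (A : 'M[F]_(m + r)) :
  (i <= m)%N ->
  trunc (block_mx C1 0 0 C2) i A = block_mx (trunc C1 i (ulsubmx A)) 0 0 C2.
Proof.
move=> leim; apply/matrixP => j k; rewrite mxE.
case: (splitP j) => j' jE; case: (splitP k) => k' kE.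
- have -> : j = lshift r j' by apply: val_inj.
  have -> : k = lshift r k' by apply: val_inj.
  by rewrite !block_mxEul !mxE.
- have -> : j = lshift r j' by apply: val_inj.
  have -> : k = rshift m k' by apply: val_inj.
  by rewrite !block_mxEur /= [(_ + _ < _)%N]ltnNge (leq_trans leim) ?leq_addr ?andbF.
- have -> : j = rshift m j' by apply: val_inj.
  have -> : k = lshift r k' by apply: val_inj.
  by rewrite !block_mxEdl /= [(_ + _ < _)%N]ltnNge (leq_trans leim) ?leq_addr.
- have -> : j = rshift m j' by apply: val_inj.
  have -> : k = rshift m k' by apply: val_inj.
  by rewrite !block_mxEdr /= [(_ + _ < _)%N]ltnNge (leq_trans leim) ?leq_addr.
Qed.

Lemma is_trig_lblock m r (b : 'M[F]_m) (R : 'M[F]_(r, m)) (c : 'M[F]_r) :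
  is_trig_mx b -> is_trig_mx c -> is_trig_mx (block_mx b 0 R c).
Proof. by move=> tb tc; rewrite is_trig_block_mx // eqxx tb. Qed.

Lemma LU_factorization n (A : 'M[F]_n) :
  (forall i, (i <= n)%N -> \det (trunc 1%:M i A) != 0) ->
  exists b u, [/\ is_trig_mx b, upper_unitriangular u & A = b *m u].
Proof.
elim: n A => [|m IHm] A detA.
  exists 1%:M, 1%:M; split; rewrite ?scalar_mx_is_trig //; last by apply/matrixP => -[].
  by case.
move: A detA; rewrite -addn1 => A detA.
have [|b [u [tb uu Aul]]] := IHm (ulsubmx A).
  move=> i leim; have := detA i (leq_trans leim (leq_addr 1 m)).
  by rewrite scalar_mx_block trunc_block // det_ublock det1 mulr1.
have ub : b \in unitmx.
  have := detA m (leq_addr _ _); rewrite scalar_mx_block trunc_block //.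
  rewrite trunc_full det_ublock det1 mulr1 Aul det_mulmx mulf_eq0 negb_or.
  by case/andP => db _; rewrite unitmxE unitfE.
have uu' := upper_unitriangular_unit uu.
pose R := dlsubmx A *m invmx u; pose C := invmx b *m ursubmx A.
exists (block_mx b 0 R (drsubmx A - R *m C)), (block_mx u C 0 1%:M); split.
- apply: is_trig_lblock => //; apply/is_trig_mxP => i j.
  by rewrite (ord1 i) (ord1 j).
- move=> i j; case: (splitP i) => i' iE; case: (splitP j) => j' jE leji.
  + have -> : i = lshift 1 i' by apply: val_inj.
    have -> : j = lshift 1 j' by apply: val_inj.
    by rewrite block_mxEul uu -?jE -?iE // (inj_eq (@lshift_inj _ _)).
  + by have := ltn_ord i'; rewrite -iE ltnNge (leq_trans _ leji) // jE leq_addr.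
  + have -> : i = rshift m i' by apply: val_inj.
    have -> : j = lshift 1 j' by apply: val_inj.
    by rewrite block_mxEdl mxE eq_rlshift.
  + have -> : i = rshift m i' by apply: val_inj.
    have -> : j = rshift m j' by apply: val_inj.
    by rewrite block_mxEdr mxE (inj_eq (@rshift_inj _ _)).
- rewrite mulmx_block !mul0mx !mulmx0 !addr0 !mulmx1 -Aul.
  by rewrite /R mulmxKV // /C mulKVmx // addrC subrK submxK.
Qed.

(** If b C1 b^T is the leading block of a symmetric or alternating matrix and C1
    is invertible, the rows below it can be cleared, which leaves a form S on
    the last coordinates. *)
Lemma congruence_step m r (eps : F) (C1 b : 'M[F]_m) (C2 : 'M[F]_r) (A : 'M[F]_(m + r)) :
    eps * eps = 1 -> A^T = eps *: A -> C1^T = eps *: C1 -> C1 \in unitmx ->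
    is_trig_mx b -> b \in unitmx -> ulsubmx A = b *m C1 *m b^T ->
    (forall S : 'M[F]_r, S^T = eps *: S ->
      exists2 c, is_trig_mx c & S = c *m C2 *m c^T) ->
  exists2 b', is_trig_mx b' & A = b' *m block_mx C1 0 0 C2 *m b'^T.
Proof.
move=> eps2 symA symC uC tb ub Aul congS.
have [R RE] : exists R, R *m (C1 *m b^T) = dlsubmx A.
  by exists (dlsubmx A *m invmx (C1 *m b^T)); rewrite mulmxKV // unitmx_mul uC unitmx_tr.
have urE : ursubmx A = eps *: (dlsubmx A)^T.
  by rewrite trmx_dlsub symA; apply/matrixP => i j; rewrite !mxE mulrA eps2 mul1r.
have symdr : (drsubmx A)^T = eps *: drsubmx A.
  by rewrite trmx_drsub symA; apply/matrixP => i j; rewrite !mxE.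
have [|c tc cE] := congS (drsubmx A - R *m C1 *m R^T).
  rewrite linearB /= symdr !trmx_mul trmxK symC scalerBr -scalemxAl.
  by rewrite -scalemxAr mulmxA.
exists (block_mx b 0 R c); first exact: is_trig_lblock.
rewrite tr_block_mx trmx0 !mulmx_block !mul0mx !mulmx0 !addr0 !add0r -Aul -cE.
rewrite [_ + (_ - _)]addrC subrK -[R *m C1 *m b^T]mulmxA RE.
suffices -> : b *m C1 *m R^T = ursubmx A by rewrite mul0mx addr0 submxK.
by rewrite urE -RE !trmx_mul trmxK symC -scalemxAr -scalemxAl scalerA eps2 scale1r.
Qed.

(** The transpose is not conjugated: over an algebraically closed field every pivot
    is a square, and no positivity is involved. *)
Lemma cholesky n (A : 'M[F]_n) :
  A^T = A -> (forall i, (i <= n)%N -> \det (trunc 1%:M i A) != 0) ->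
  exists2 b : 'M[F]_n, is_trig_mx b & A = b *m b^T.
Proof.
elim: n A => [|m IHm] A symA detA.
  by exists 1%:M; rewrite ?scalar_mx_is_trig //; apply/matrixP => -[].
move: A symA detA; rewrite -addn1 => A symA detA.
have [||b tb Aul] := IHm (ulsubmx A).
- by rewrite trmx_ulsub symA.
- move=> i leim; have := detA i (leq_trans leim (leq_addr 1 m)).
  by rewrite scalar_mx_block trunc_block // det_ublock det1 mulr1.
have ub : b \in unitmx.
  have := detA m (leq_addr _ _); rewrite scalar_mx_block trunc_block //.
  rewrite trunc_full det_ublock det1 mulr1 Aul det_mulmx mulf_eq0 negb_or.
  by case/andP => db _; rewrite unitmxE unitfE.
have [] := @congruence_step _ 1 1 1%:M b 1%:M A; rewrite ?mulr1 ?scale1r ?trmx1 ?unitmx1 ?mulmx1 //.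
  move=> S _; exists (sqrtC (S 0 0))%:M; first exact: scalar_mx_is_trig.
  rewrite mulmx1 tr_scalar_mx -scalar_mxM -expr2 sqrtCK.
  by apply/matrixP => i j; rewrite !ord1 mxE eqxx mulr1n.
by move=> b' tb' AE; exists b' => //; rewrite AE -scalar_mx_block mulmx1.
Qed.

(** For even n, the block diagonal alternating form with blocks (0 1; -1 0). *)
Definition alt_form n : 'M[F]_n := \matrix_(i, j)
  ((~~ odd i && (j == i.+1 :> nat))%:R - (~~ odd j && (i == j.+1 :> nat))%:R).

Lemma alt_form_tr n : (alt_form n)^T = - alt_form n.
Proof. by apply/matrixP => i j; rewrite !mxE opprB. Qed.

Lemma alt_form_block m : ~~ odd m ->
  alt_form (m + 2) = block_mx (alt_form m) 0 0 (alt_form 2).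
Proof.
move=> em; apply/matrixP => j k; rewrite mxE.
case: (splitP j) => j' jE; case: (splitP k) => k' kE.
- have -> : j = lshift 2 j' by apply: val_inj.
  have -> : k = lshift 2 k' by apply: val_inj.
  by rewrite block_mxEul mxE.
- have -> : j = lshift 2 j' by apply: val_inj.
  have -> : k = rshift m k' by apply: val_inj.
  rewrite block_mxEur mxE /=.
  have -> : (j' == (m + k').+1 :> nat) = false.
    by rewrite ltn_eqF // ltnS (leq_trans (ltnW (ltn_ord j'))) ?leq_addr.
  rewrite andbF subr0; case: andP => // -[ej /eqP eqm].
  have le_k : k' = 0%N :> nat /\ m = j'.+1.
    have := ltn_ord j'; rewrite -eqm => lej; have k0 : (k' = 0 :> nat)%N.
      by apply/eqP; rewrite -leqn0 -(leq_add2l m) addn0.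
    by rewrite k0 addn0.
  by case: le_k => _ mE; rewrite mE /= ej in em.
- have -> : j = rshift m j' by apply: val_inj.
  have -> : k = lshift 2 k' by apply: val_inj.
  rewrite block_mxEdl mxE /=.
  have -> : (k' == (m + j').+1 :> nat) = false.
    by rewrite ltn_eqF // ltnS (leq_trans (ltnW (ltn_ord k'))) ?leq_addr.
  rewrite andbF sub0r; case: andP => [[ej /eqP eqm]|]; last by rewrite oppr0.
  have le_k : j' = 0%N :> nat /\ m = k'.+1.
    have := ltn_ord k'; rewrite -eqm => lej; have k0 : (j' = 0 :> nat)%N.
      by apply/eqP; rewrite -leqn0 -(leq_add2l m) addn0.
    by rewrite k0 addn0.
  by case: le_k => _ mE; rewrite mE /= ej in em.
- have -> : j = rshift m j' by apply: val_inj.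
  have -> : k = rshift m k' by apply: val_inj.
  by rewrite block_mxEdr !mxE /= !oddD (negPf em) -!addnS !eqn_add2l.
Qed.

Lemma alt_form2 : \det (alt_form 2) = 1.
Proof.
rewrite (expand_det_row _ ord0) !big_ord_recl big_ord0 /cofactor !det_mx11 !mxE /=.
by rewrite expr1 !(subr0, sub0r, addr0, add0r, mulr0, mul0r, mul1r, mulr1, mulrNN).
Qed.

Lemma alternating_factorization n (A : 'M[F]_n) :
  ~~ odd n -> A^T = - A ->
  (forall i, (i <= n)%N -> ~~ odd i -> \det (trunc (alt_form n) i A) != 0) ->
  exists2 b : 'M[F]_n, is_trig_mx b & A = b *m alt_form n *m b^T.
Proof.
move=> en; rewrite -[n]odd_double_half (negPf en) add0n in A *; move: A.
elim: (n./2) => {n en} [|k IHk] A altA detA.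
  by exists 1%:M; rewrite ?scalar_mx_is_trig //; apply/matrixP => -[].
move: A altA detA; rewrite doubleS -addn2; move: IHk.
have : ~~ odd k.*2 by rewrite odd_double.
move: k.*2 => m em IHm A altA detA.
have det_block i : (i <= m)%N -> ~~ odd i -> \det (trunc (alt_form m) i (ulsubmx A)) != 0.
  move=> leim ei; have := detA i (leq_trans leim (leq_addr 2 m)) ei.
  by rewrite alt_form_block // trunc_block // det_ublock alt_form2 mulr1.
have [|b tb Aul] := IHm (ulsubmx A) _ det_block.
  by rewrite trmx_ulsub altA; apply/matrixP => i j; rewrite !mxE.
have uJ : alt_form m \in unitmx.
  by have := det_block 0%N isT isT; rewrite trunc0 unitmxE unitfE.
have ub : b \in unitmx.
  have := det_block m (leqnn m) em; rewrite trunc_full Aul !det_mulmx.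
  by rewrite !mulf_eq0 !negb_or unitmxE unitfE => /andP[/andP[]].
have [] := @congruence_step m 2 (-1) (alt_form m) b (alt_form 2) A;
  rewrite ?mulrNN ?mulr1 ?scaleN1r ?alt_form_tr //.
  move=> S; rewrite scaleN1r => altS.
  exists (diag_mx (\row_j (if j == 0 then S 0 1 else 1))).
    exact: diag_mx_is_trig.
  have Sdiag j : S j j = 0.
    have /eqP := congr1 (fun B : 'M_2 => B j j) altS; rewrite !mxE -subr_eq0 opprK.
    by rewrite -mulr2n mulrn_eq0 => /eqP.
  have S10 : S 1 0 = - S 0 1.
    by have := congr1 (fun B : 'M_2 => B 0 1) altS; rewrite !mxE.
  rewrite tr_diag_mx mul_mx_diag mul_diag_mx.
  apply/matrixP => i j; rewrite !mxE.
  have [i0|i1] : i = 0 \/ i = 1 by case: i => [[|[|//]]] p; [left|right]; apply: val_inj.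
    have [j0|j1] : j = 0 \/ j = 1 by case: j => [[|[|//]]] p; [left|right]; apply: val_inj.
      by rewrite i0 j0 Sdiag /= subrr mulr0 mul0r.
    by rewrite i0 j1 /= subr0 !mulr1.
  have [j0|j1] : j = 0 \/ j = 1 by case: j => [[|[|//]]] p; [left|right]; apply: val_inj.
    by rewrite i1 j0 /= S10 sub0r mulrN1 mulN1r.
  by rewrite i1 j1 Sdiag /= subrr mulr0 mul0r.
by move=> b' tb' AE; exists b' => //; rewrite AE alt_form_block.
Qed.

End Factorization.

(** * Invariants of a subgroup in an irreducible module *)

Section TriangularWeights.
Variables (F : numClosedFieldType) (n : nat).
Implicit Types (b g : 'M[F]_n) (lam : 'X_{1..n}).

Definition diag_pow b lam : F := \prod_i b i i ^+ lam i.

Lemma trig_unit_diag b : is_trig_mx b -> b \in unitmx -> forall i, b i i != 0.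
Proof.
move=> tb; rewrite unitmxE unitfE det_trig // => /prodf_neq0 nz i.
exact: nz.
Qed.

Lemma trCK g : map_mx Num.conj (map_mx Num.conj g^T)^T = g.
Proof. by apply/matrixP => i j; rewrite !mxE conjCK. Qed.

Definition semi_invariant lam (f : {mpoly F[n * n]}) : Prop :=
  forall b g, is_trig_mx b -> b \in unitmx ->
    mxeval f (b *m g) = diag_pow b lam * mxeval f g.

Lemma semi_invariant_homog lam f : semi_invariant lam f -> f \is (mdeg lam).-homog.
Proof.
move=> semif; apply: homog_meval_scale => y.
have := semif 2%:R%:M (vec_mx y) (scalar_mx_is_trig _ _).
rewrite unitmxE det_scalar unitfE expf_neq0 ?pnatr_eq0 // => /(_ isT).
rewrite mul_scalar_mx /mxeval linearZ /= vec_mxK => ->; congr (_ * _).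
by rewrite mdegE -prodrXr; apply: eq_bigr => i _; rewrite mxE eqxx mulr1n.
Qed.

End TriangularWeights.

Section Irreducible.
Variables (F : numClosedFieldType) (n : nat) (V : vectType F).
Variable a : 'M[F]_n -> 'End(V).
Hypotheses (act_a : is_action a) (pol_a : is_polynomial_action a).
Variable h : V -> V -> F.
Hypothesis form_h : is_inv_form a h.
Variables (U : {vspace V}) (lam : 'X_{1..n}) (v : V).
Hypotheses (irrU : gl_irreducible a U) (vU : v \in U) (v_neq0 : v != 0).
Hypothesis v_unip : forall g, upper_unitriangular g -> a g v = v.
Hypothesis v_torus : is_weight a v lam.

Lemma form_vv_neq0 : h v v != 0.
Proof. by apply: contra v_neq0 => /eqP/(form_eq0 form_h)->. Qed.

(** The adjoint of b is upper triangular, and v is a common eigenvector of the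
    upper triangular matrices. *)
Lemma form_lower b u : is_trig_mx b -> b \in unitmx ->
  h (a b u) v = diag_pow b lam * h u v.
Proof.
move=> tb ub; have b_neq0 := trig_unit_diag tb ub.
rewrite (form_act form_h) //; set c := map_mx _ _.
pose t := \row_i (b i i)^*.
have t_neq0 i : t 0 i != 0 by rewrite mxE conjC_eq0.
pose u' : 'M[F]_n := \matrix_(i, j) (c i j / t 0 j).
have cE : c = u' *m diag_mx t.
  by rewrite mul_mx_diag; apply/matrixP => i j; rewrite !mxE divfK // conjC_eq0.
have uu' : upper_unitriangular u'.
  move=> i j leji; rewrite !mxE; have [->|ne] := eqVneq i j.
    by rewrite divff ?conjC_eq0.
  have ltji : (j < i)%N by rewrite ltn_neqAle leji val_eqE eq_sym ne.
  have -> : b j i = 0 by apply: (is_trig_mxP tb).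
  by rewrite conjC0 mul0r.
rewrite cE (actM act_a) ?diag_unitmx ?upper_unitriangular_unit // v_torus //.
rewrite linearZ /= v_unip // (formZr form_h); congr (_ * _).
rewrite /tpow rmorph_prod; apply: eq_bigr => i _.
by rewrite mxE rmorphXn /= conjCK.
Qed.

(** The vectors u with <g u, v> = 0 for all g form a submodule without v. *)
Lemma irreducible_separated u :
  u \in U -> (forall g, g \in unitmx -> h (a g u) v = 0) -> u = 0.
Proof.
move=> uU u0; case: irrU => _ stU minU.
have [|c x y [xU x0] [yU y0]|U0 U0E] := @vspace_of_closed _ V
    (fun x => x \in U /\ forall g, g \in unitmx -> h (a g x) v = 0).
- by split=> [|g _]; [apply: mem0v | rewrite linear0 (form0l form_h)].
- split=> [|g ug]; first by rewrite memvD ?memvZ.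
  by rewrite linearD linearZ /= (form_linear form_h) x0 // y0 // mulr0 addr0.
have [||U00|U0U] := minU U0.
- by apply/subvP => x /U0E[].
- move=> g ug x /U0E[xU x0]; apply/U0E; split=> [|g' ug']; first exact: stU.
  by rewrite -(actM act_a) // x0 // unitmx_mul ug'.
- by apply/eqP; rewrite -memv0 -U00; apply/U0E.
have /U0E[_ /(_ 1%:M (unitmx1 _ _))] : v \in U0 by rewrite U0U.
by rewrite (act1 act_a) => /eqP; rewrite (negPf form_vv_neq0).
Qed.

Section Subgroup.
Variables (K : pred 'M[F]_n) (p : 'M[F]_n).
Hypotheses (up : p \in unitmx) (uK : forall k, K k -> k \in unitmx).

(** The double coset B p K, for B the lower triangular matrices, contains the
    complement of the hypersurface q = 0.  A general p allows a form preserved by K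
    that is not in general position with respect to the standard flag. *)
Definition triangular_dense : Prop :=
  exists q g0, [/\ polyfun q, q g0 != 0 & forall g, q g != 0 ->
    exists b k, [/\ is_trig_mx b, b \in unitmx, K k & g = b *m p *m k]].

Hypothesis denseK : triangular_dense.

(** On the double coset B p K the function g |-> <g u, v> is determined by its
    value at p, so it vanishes everywhere when that value is 0. *)
Lemma invariant_eq0 u :
  u \in U -> is_invariant a K u -> h (a p u) v = 0 -> u = 0.
Proof.
move=> uU invu pu0; apply: irreducible_separated => // g ug.
have [q [g0 [pq q0 qE]]] := denseK.
have [P PE] := act_polyfun pol_a (form_functional form_h v) u.
rewrite -[h _ _]/(form_functional form_h v _) PE //.
apply: (polyfun_dense (polyfun_mxeval P) pq q0) => {ug}g q_neq0.
have [b [k [tb ub Kk ->]]] := qE g q_neq0.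
have uk := uK Kk; rewrite -PE ?unitmx_mul ?ub ?up ?uk // -mulmxA.
rewrite (actM act_a) ?unitmx_mul ?up ?uk // (actM act_a) // invu //.
by rewrite -[LHS]/(h _ v) form_lower // pu0 mulr0.
Qed.

(** With k = p^-1 t p in K, the vectors p u = p k u and t p u are equal. *)
Lemma invariant_torus u (t : 'rV[F]_n) :
    u \in U -> is_invariant a K u -> u != 0 -> (forall i, t 0 i != 0) ->
    K (invmx p *m diag_mx t *m p) ->
  tpow t lam = 1.
Proof.
move=> uU invu u_neq0 t_neq0 Kt; have ut := diag_unitmx t_neq0.
have nz : h (a p u) v != 0.
  by apply: contra u_neq0 => /eqP/(invariant_eq0 uU invu)->.
apply: (mulIf nz); rewrite mul1r -{2}(invu _ Kt) -(actM act_a) ?(uK Kt) //.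
rewrite !mulmxA mulmxV // mul1mx (actM act_a) // (form_lower _ (diag_mx_is_trig t) ut).
congr (_ * _); apply: eq_bigr => i _.
by rewrite mxE eqxx mulr1n.
Qed.

Lemma dim_invariants_le1 : (\dim (U :&: invariants a K) <= 1)%N.
Proof.
set X := (U :&: _)%VS.
have XE x : x \in X -> x \in U /\ is_invariant a K x.
  by move=> /memv_capP[xU /invariantsP].
have [->|X_neq0] := eqVneq X 0%VS; first by rewrite dimv0.
have [xU invx] := XE _ (memv_pick X); set x := vpick X in xU invx.
have x_neq0 : x != 0 by rewrite vpick0.
have nz : h (a p x) v != 0.
  by apply: contra x_neq0 => /eqP/(invariant_eq0 xU invx)->.
suffices sX : (X <= <[x]>)%VS by rewrite (leq_trans (dimvS sX)) // dim_vline; case: eqP.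
apply/subvP => y /XE[yU invy]; apply/vlineP.
pose c := h (a p y) v / h (a p x) v; exists c.
apply/eqP; rewrite -subr_eq0; apply/eqP/invariant_eq0.
- by rewrite memvB ?memvZ.
- by move=> k Kk; rewrite linearB linearZ /= invy // invx.
- by rewrite linearB linearZ /= (formBl form_h) (formZl form_h) divfK // subrr.
Qed.

End Subgroup.

Lemma act_polyfun_linear (psi : {linear V -> F | *%R}) :
  exists phi : V -> {mpoly F[n * n]},
    linear phi /\ forall x g, g \in unitmx -> psi (a g x) = mxeval (phi x) g.
Proof.
pose e := vbasis {:V}.
have [P PE] := fin_all_exists (fun j : 'I_(\dim {:V}) => act_polyfun pol_a psi e`_j).
exists (fun x => \sum_j coord e j x *: P j); split=> [c x y|x g ug].
  rewrite scaler_sumr -big_split /=; apply: eq_bigr => j _.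
  by rewrite linearD linearZ /= scalerDl scalerA.
rewrite {1}(coord_vbasis (memvf x)) !linear_sum /mxeval raddf_sum /=.
by apply: eq_bigr => j _; rewrite !linearZ /= PE.
Qed.

(** The map x |-> (g |-> h (a g x) v) embeds U in the semi-invariants of weight
    lam, and u below represents on U the functional pairing with f.  Were it zero,
    the semi-invariants orthogonal to the image of U would form a nonzero module,
    which contains a highest weight vector w.  But w and the image of v are
    determined, up to a factor, on the dense set of products of a lower and an upper
    unitriangular matrix, hence proportional and orthogonal. *)
Lemma exists_invariant (K : pred 'M[F]_n) f :
    semi_invariant lam f -> f != 0 -> (forall k, K k -> k \in unitmx) ->
    (forall k g, K k -> mxeval f (g *m k) = mxeval f g) ->
  exists u, [/\ u \in U, is_invariant a K u & u != 0].
Proof.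
move=> semif f_neq0 uK invf.
have [phi [phi_lin phiE]] := act_polyfun_linear (form_functional form_h v).
have phi_act g x : g \in unitmx -> phi (a g x) = rtrans g (phi x).
  move=> ug; apply: mxeval_inj; apply: polyfun_unit_eq => [||y uy].
  - exact: polyfun_mxeval.
  - exact: polyfun_mxeval.
  by rewrite mxeval_rtrans -!phiE ?unitmx_mul ?uy // (actM act_a).
pose psi x := hfischer (phi x) f.
have psi_lin : linear_for *%R psi.
  by move=> c x y; rewrite /psi phi_lin hfischerDl hfischerZl.
pose psiL := HB.pack_for {linear V -> F | *%R} psi
  (GRing.isLinear.Build _ _ _ _ _ psi_lin).
have [u uU uE] := form_riesz form_h U psiL.
have psiE x : x \in U -> hfischer (phi x) f = h x u := uE x.
have [_ stU _] := irrU.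
exists u; split=> // [k Kk|].
  have uk := uK k Kk; have uk' := trC_unitmx uk.
  apply/eqP; rewrite -subr_eq0; apply/eqP; set w := a k u - u.
  have wU : w \in U by rewrite memvB ?stU.
  apply: (form_eq0 form_h); rewrite {2}/w (formBr form_h) -{1}(trCK k).
  rewrite -(form_act form_h) // -!psiE ?stU // phi_act // hfischer_rtrans trCK.
  have -> : rtrans k f = f by apply: mxeval_inj => g; rewrite mxeval_rtrans invf.
  by rewrite subrr.
apply/eqP => u0.
have orth x : x \in U -> hfischer (phi x) f = 0.
  by move=> /psiE->; rewrite u0 (formC form_h) (form0l form_h) conjC0.
pose X := symPow F (n * n) (mdeg lam).
have [|c w1 w2 [s1 o1] [s2 o2]|M ME] := @vspace_of_closed _ X
    (fun w => semi_invariant lam (val w) /\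
              forall x, x \in U -> hfischer (phi x) (val w) = 0).
- split=> [b g _ _|x _]; first by rewrite /mxeval !meval0 mulr0.
  by rewrite hfischer_conj /hfischer /fischer msupp0 big_nil conjC0.
- split=> [b g tb ub|x xU] /=.
    rewrite /mxeval !mevalD !mevalZ -!/(mxeval _ _) s1 // s2 // mulrDr.
    by rewrite mulrCA.
  rewrite hfischer_conj hfischerDl hfischerZl rmorphD rmorphM /=.
  by rewrite -!hfischer_conj o1 // o2 // mulr0 addr0.
pose f' : X := DHomog (semi_invariant_homog semif).
have M_neq0 : M != 0%VS.
  apply: contra f_neq0 => /eqP M0; have : f' \in M by apply/ME.
  by rewrite M0 memv0 => /eqP/(congr1 val) /= ->.
have stM : gl_stable (@rtrans_act F n (mdeg lam)) M.
  move=> g ug w /ME[semiw ow]; apply/ME; rewrite rtrans_actE; split.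
    by move=> b g' tb ub; rewrite !mxeval_rtrans -mulmxA semiw.
  move=> x xU; rewrite -(trCK g) -hfischer_rtrans -phi_act ?trC_unitmx // ow //.
  exact/stU/xU/trC_unitmx.
have [mu _ [w [/ME[semiw ow] w_neq0 w_unip _]]] := exists_highest_weight
  (rtrans_is_action F n _) (rtrans_is_polynomial F n _) M_neq0 stM.
set P := val w in semiw ow; set Q := phi v in ow *.
have Q1 : mxeval Q 1%:M = h v v by rewrite -phiE ?unitmx1 // (act1 act_a).
have prop g : mxeval (h v v *: P - mxeval P 1%:M *: Q) g = 0.
  pose q (g : 'M[F]_n) := \prod_(i < n.+1) \det (trunc 1%:M i g).
  apply: (@polyfun_dense _ _ _ q 1%:M (polyfun_mxeval _)) => {g}.
  - apply: polyfun_prod => i _; apply: polyfun_det => j k.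
    case jk: ((j < i) && (k < i))%N.
      by apply: eq_polyfun (polyfun_entry _ j k) => g; rewrite mxE jk.
    by apply: eq_polyfun (polyfun_const _ ((1%:M : 'M[F]_n) j k)) => g; rewrite [RHS]mxE jk.
  - by rewrite /q big1 ?oner_neq0 // => i _; rewrite trunc_id det1.
  move=> g /prodf_neq0 q_neq0.
  have [i le_in|b [y [tb uy gE]]] := @LU_factorization _ _ g.
    by have := q_neq0 (inord i) isT; rewrite inordK.
  have ub : b \in unitmx.
    have := q_neq0 ord_max isT; rewrite /= trunc_full gE det_mulmx mulf_eq0.
    by rewrite negb_or unitmxE unitfE => /andP[].
  have uuy := upper_unitriangular_unit uy.
  have PE : mxeval P g = diag_pow b lam * mxeval P 1%:M.
    rewrite gE semiw //; congr (_ * _).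
    transitivity (mxeval (val (rtrans_act (mdeg lam) y w)) 1%:M).
      by rewrite rtrans_actE mxeval_rtrans mul1mx.
    by rewrite w_unip.
  have QE : mxeval Q g = diag_pow b lam * h v v.
    by rewrite gE -phiE ?unitmx_mul ?ub // (actM act_a) // v_unip // -[LHS]/(h _ v) form_lower.
  rewrite /mxeval mevalB !mevalZ -!/(mxeval _ _) PE QE.
  by rewrite mulrCA [mxeval P _ * _]mulrCA [mxeval P _ * _]mulrC subrr.
have eqPQ : h v v *: P = mxeval P 1%:M *: Q.
  apply/eqP; rewrite -subr_eq0; apply/eqP/mxeval_inj => g.
  by rewrite prop /mxeval meval0.
have : hfischer P P = 0.
  apply: (mulfI form_vv_neq0); rewrite mulr0 -hfischerZl eqPQ hfischerZl ow //.
  by rewrite mulr0.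
by move/hfischer_eq0 => P0; case/eqP: w_neq0; apply: val_inj.
Qed.

End Irreducible.

(** * The Pfaffian *)

Section Pfaffian.
Variables (F : numClosedFieldType) (k : nat).
Implicit Types (A g M : 'M[F]_(k + k)).

Definition std_form : 'M[F]_(k + k) := block_mx 0 1%:M (- 1%:M) 0.

(** 2 ^ k * k! times the Pfaffian of A, when A is alternating. *)
Definition pfaff A : F := \sum_(s : 'S_(k + k))
  (-1) ^+ s * \prod_j A (s (lshift k j)) (s (rshift k j)).

Let pair_fun (f : {ffun 'I_k -> 'I_(k + k) * 'I_(k + k)}) :
    {ffun 'I_(k + k) -> 'I_(k + k)} :=
  [ffun i => match split i with inl j => (f j).1 | inr j => (f j).2 end].

Let pair_fun_bij : bijective pair_fun.
Proof.
exists (fun e : {ffun 'I_(k + k) -> 'I_(k + k)} =>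
  [ffun j => (e (lshift k j), e (rshift k j))]) => [f|e]; apply/ffunP => i.
  rewrite !ffunE -[lshift k i]/(unsplit (inl i)) -[rshift k i]/(unsplit (inr i)).
  by rewrite !unsplitK -surjective_pairing.
by rewrite !ffunE -{2}(splitK i); case: (split i) => j; rewrite ffunE.
Qed.

Let prod_split (f : 'I_(k + k) -> F) :
  \prod_i f i = \prod_j (f (lshift k j) * f (rshift k j)).
Proof. by rewrite big_split_ord big_split. Qed.

(** As for the multiplicativity of the determinant: after expansion, each choice e
    of column indices contributes a determinant formed from columns of g, which
    vanishes unless e is a permutation. *)
Lemma pfaff_congr g A : pfaff (g *m A *m g^T) = \det g * pfaff A.
Proof.
pose term (e : {ffun 'I_(k + k) -> 'I_(k + k)}) :=
  \prod_j A (e (lshift k j)) (e (rshift k j)).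
have expand (s : 'S_(k + k)) :
    \prod_j (g *m A *m g^T) (s (lshift k j)) (s (rshift k j)) =
    \sum_(e : {ffun 'I_(k + k) -> 'I_(k + k)}) (\prod_i g (s i) (e i)) * term e.
  rewrite (reindex pair_fun) /=; last exact: onW_bij pair_fun_bij.
  transitivity (\prod_j \sum_(xy : 'I_(k + k) * 'I_(k + k))
      g (s (lshift k j)) xy.1 * A xy.1 xy.2 * g (s (rshift k j)) xy.2).
    apply: eq_bigr => j _; rewrite -(pair_bigA _ (fun x y =>
      g (s (lshift k j)) x * A x y * g (s (rshift k j)) y)) /= exchange_big /= mxE.
    apply: eq_bigr => y _; rewrite !mxE mulr_suml.
    by apply: eq_bigr => x _.
  rewrite bigA_distr_bigA /=; apply: eq_bigr => f _.
  rewrite prod_split /term -big_split /=; apply: eq_bigr => j _.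
  rewrite !ffunE -[lshift k j]/(unsplit (inl j)) -[rshift k j]/(unsplit (inr j)).
  by rewrite !unsplitK mulrAC.
rewrite /pfaff; under eq_bigr do rewrite expand mulr_sumr.
rewrite exchange_big /=.
have detE (e : {ffun 'I_(k + k) -> 'I_(k + k)}) :
    \sum_(s : 'S_(k + k)) (-1) ^+ s * ((\prod_i g (s i) (e i)) * term e) =
    \det (\matrix_(i, j) g j (e i)) * term e.
  rewrite mulr_suml; apply: eq_bigr => s _; rewrite mulrA; congr (_ * _ * _).
  by apply: eq_bigr => i _; rewrite mxE.
under eq_bigr do rewrite detE.
rewrite (bigID (fun e : {ffun 'I_(k + k) -> 'I_(k + k)} => injectiveb e)) /=.
rewrite [X in _ + X]big1 ?addr0 => [|e /injectivePn[i1 [i2 ne eq_e]]]; last first.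
  by rewrite (determinant_alternate ne) ?mul0r // => j; rewrite !mxE eq_e.
rewrite (reindex (@pval _)) /=; last first.
  pose to_perm := insubd (1%g : 'S_(k + k)).
  by exists to_perm => /= e inj_e; first apply: val_inj; apply: insubdK.
rewrite mulr_sumr; apply: eq_big => [s|s _]; first by rewrite (valP s).
have -> : \matrix_(i, j) g j (pval s i) = row_perm s g^T.
  by apply/matrixP => i j; rewrite !mxE pvalE.
rewrite row_permE det_mulmx det_perm det_tr -mulrA mulrCA; congr (_ * (_ * _)).
by apply: eq_bigr => j _; rewrite !pvalE.
Qed.

(** Commuting with the form means having blocks (A, B; -B, A), and the determinant of
    a real matrix of this shape is |det (A + i B)|^2. *)
Lemma det_commute_std_ge0 M :
  M *m std_form = std_form *m M -> map_mx Num.conj M = M -> 0 <= \det M.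
Proof.
rewrite -[M]submxK; set A := ulsubmx M; set B := ursubmx M; set C := dlsubmx M.
set E := drsubmx M.
rewrite /std_form !mulmx_block !mulmx0 !mul0mx !mulmx1 !mul1mx !addr0 !add0r.
rewrite !mulmxN !mulNmx !mulmx1 !mul1mx => /eq_block_mx[CE EA _ _] realM.
have {CE}CE : C = - B by rewrite CE.
have {EA}EA : E = A by rewrite EA.
move: realM; rewrite map_block_mx => /eq_block_mx[realA realB _ _].
rewrite CE EA.
(* L and R block-triangularize the matrix, with diagonal blocks A - i B, A + i B. *)
pose L : 'M[F]_(k + k) := block_mx 1%:M ('i *: 1%:M) 0 1%:M.
pose R : 'M[F]_(k + k) := block_mx 1%:M (- 'i *: 1%:M) 0 1%:M.
have detLMR : \det (L *m block_mx A B (- B) A *m R) = \det (block_mx A B (- B) A).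
  by rewrite !det_mulmx /L /R !det_ublock !det1 !mulr1 mul1r.
have ii : 'i * 'i = -1 :> F by rewrite -expr2 sqrCi.
have prodE : L *m block_mx A B (- B) A *m R =
    block_mx (A - 'i *: B) 0 (- B) (A + 'i *: B).
  rewrite /L /R !mulmx_block !mulmx0 !mul0mx !mulmx1 !mul1mx !addr0 !add0r.
  rewrite -!scalemxAl -!scalemxAr !mul1mx !mulmx1 scalerN; congr block_mx.
    by rewrite scalerDr !scaleNr scalerN scalerA ii scaleN1r opprK addrA subrK addNr.
  by rewrite scalerN scaleNr opprK addrC.
rewrite -detLMR prodE det_lblock.
have -> : A - 'i *: B = map_mx Num.conj (A + 'i *: B).
  by rewrite map_mxD map_mxZ realA realB /= conjCi scaleNr.
by rewrite det_map_mx mulrC mul_conjC_ge0.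
Qed.

(** A nonzero term of the sum, for a permutation s, is the determinant of the matrix
    of s with some rows negated, which is orthogonal and preserves the form, hence
    commutes with it.  So all terms are nonnegative, and that of s = 1 is 1. *)
Lemma pfaff_std_neq0 : pfaff std_form != 0.
Proof.
have stdlr i j : std_form (lshift k i) (rshift k j) = (i == j)%:R.
  by rewrite block_mxEur mxE.
have stdll i j : std_form (lshift k i) (lshift k j) = 0 by rewrite block_mxEul mxE.
have stdrr i j : std_form (rshift k i) (rshift k j) = 0 by rewrite block_mxEdr mxE.
have stdrl i j : std_form (rshift k i) (lshift k j) = - (i == j)%:R.
  by rewrite block_mxEdl !mxE.
have std_tr x y : std_form y x = - std_form x y.
  by case: (split_ordP x) => x' ->; case: (split_ordP y) => y' ->;
     rewrite ?stdll ?stdlr ?stdrl ?stdrr ?oppr0 ?opprK // eq_sym.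
have std_partner x y z : std_form x y != 0 -> std_form x z != 0 -> y = z.
  case: (split_ordP x) => x' ->; case: (split_ordP y) => y' ->;
    case: (split_ordP z) => z' ->; rewrite ?stdll ?stdlr ?stdrl ?stdrr ?eqxx //.
    by rewrite !pnatr_eq0 !eqb0 !negbK => /eqP<- /eqP<-.
  by rewrite !oppr_eq0 !pnatr_eq0 !eqb0 !negbK => /eqP<- /eqP<-.
have std_sq x y : std_form x y != 0 -> std_form x y * std_form x y = 1.
  case: (split_ordP x) => x' ->; case: (split_ordP y) => y' ->;
    rewrite ?stdll ?stdlr ?stdrl ?stdrr ?mulrNN ?oppr_eq0 ?eqxx // pnatr_eq0 eqb0 negbK.
    by move=> ->; rewrite mulr1.
  by move=> ->; rewrite mulr1.
have std_real x y : (std_form x y)^* = std_form x y.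
  by case: (split_ordP x) => x' ->; case: (split_ordP y) => y' ->;
    rewrite ?stdll ?stdlr ?stdrl ?stdrr ?rmorphN /= ?conjC0 ?conjC_nat.
have term_ge0 (s : 'S_(k + k)) :
    0 <= (-1) ^+ s * \prod_j std_form (s (lshift k j)) (s (rshift k j)).
  have [/eqP->|nz] := boolP (\prod_j std_form (s (lshift k j)) (s (rshift k j)) == 0).
    by rewrite mulr0.
  pose c j := std_form (s (lshift k j)) (s (rshift k j)).
  have c_neq0 j : c j != 0 by move/prodf_neq0: nz; apply.
  pose d : 'rV[F]_(k + k) := row_mx (\row_j c j) (const_mx 1).
  have dl j : d 0 (lshift k j) = c j by rewrite row_mxEl mxE.
  have dr j : d 0 (rshift k j) = 1 by rewrite row_mxEr mxE.
  pose M := diag_mx d *m perm_mx s.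
  have ME i j : M i j = d 0 i * (s i == j)%:R by rewrite /M mul_diag_mx !mxE.
  have <- : \det M = (-1) ^+ s * \prod_j c j.
    rewrite det_mulmx det_diag det_perm mulrC; congr (_ * _).
    rewrite big_split_ord /= [X in _ * X]big1 ?mulr1 => [|j _]; last by rewrite dr.
    by apply: eq_bigr => j _; rewrite dl.
  have std_s x y : (M *m std_form *m M^T) x y = d 0 x * d 0 y * std_form (s x) (s y).
    rewrite mxE (bigD1 (s y)) //= big1 ?addr0 => [|z ne]; last first.
      by rewrite [M^T _ _]mxE ME eq_sym (negPf ne) !mulr0.
    rewrite [M^T _ _]mxE ME eqxx mulr1 mxE (bigD1 (s x)) //= big1 ?addr0 => [|z ne].
      by rewrite ME eqxx mulr1 mulrAC.
    by rewrite ME eq_sym (negPf ne) mulr0 mul0r.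
  have MJ : M *m std_form *m M^T = std_form.
    apply/matrixP => x y; rewrite std_s.
    have std0 i z : z != s (rshift k i) -> std_form (s (lshift k i)) z = 0.
      by move=> ne; apply/eqP; apply: contraNT ne => /(std_partner _ _ _ (c_neq0 i)) ->.
    have std0' i z : z != s (lshift k i) -> std_form (s (rshift k i)) z = 0.
      move=> ne; apply/eqP; apply: contraNT ne => ne0; apply/eqP/esym/std_partner/ne0.
      by rewrite std_tr oppr_eq0 c_neq0.
    case: (split_ordP x) => x' ->; case: (split_ordP y) => y' ->;
      rewrite ?stdll ?stdlr ?stdrl ?stdrr ?dl ?dr ?mul1r ?mulr1.
    - by rewrite std0 ?mulr0 // (inj_eq perm_inj) eq_lrshift.
    - have [<-|ne] := eqVneq x' y'; first exact: (std_sq _ _ (c_neq0 x')).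
      by rewrite std0 ?mulr0 // (inj_eq perm_inj) (inj_eq (@rshift_inj _ _)) eq_sym.
    - have [<-|ne] := eqVneq x' y'.
        by rewrite std_tr -/(c x') mulrN; congr (- _); apply: (std_sq _ _ (c_neq0 x')).
      by rewrite std0' ?mulr0 ?oppr0 // (inj_eq perm_inj) (inj_eq (@lshift_inj _ _)) eq_sym.
    - by rewrite std0' // (inj_eq perm_inj) eq_rlshift.
  have MM : M *m M^T = 1%:M.
    rewrite /M trmx_mul tr_diag_mx mulmxA -[_ *m perm_mx s *m _]mulmxA.
    rewrite tr_perm_mx -perm_mxM mulgV perm_mx1 mulmx1 mulmx_diag.
    rewrite -diag_const_mx; congr diag_mx; apply/rowP => x; rewrite mxE [RHS]mxE.
    case: (split_ordP x) => x' ->; last by rewrite dr mulr1.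
    by rewrite dl [c _ * _]std_sq // c_neq0.
  apply: det_commute_std_ge0.
    by rewrite -{2}MJ -!mulmxA (mulmx1C MM) !mulmx1.
  apply/matrixP => x y; rewrite mxE ME rmorphM /= conjC_nat; congr (_ * _).
  by case: (split_ordP x) => x' ->; rewrite ?dl ?dr ?conjC1 // /c std_real.
apply: lt0r_neq0; rewrite /pfaff (bigD1 1%g) //= ltr_wpDr ?sumr_ge0 //.
rewrite odd_perm1 expr0 mul1r big1 ?ltr01 // => j _.
by rewrite !perm1 stdlr eqxx.
Qed.

End Pfaffian.

(** * Semi-invariants *)

Section SemiInvariants.
Variables (F : numClosedFieldType) (n : nat).
Implicit Types (b g A C : 'M[F]_n) (lam : 'X_{1..n}).

Lemma sum_gaps lam (j : 'I_n) : is_partition lam ->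
  (\sum_(i < n | j <= i) mnm_gaps lam i)%N = lam j.
Proof.
move=> plam; pose f k := nth 0%N lam k.
have fE (i : 'I_n) : f i = lam i by rewrite /f -mnm_nth.
have fn : f n = 0%N by rewrite /f nth_default // size_tuple.
have f_dec k : (f k.+1 <= f k)%N.
  case: (ltnP k.+1 n) => [lt1|le1]; last by rewrite /f nth_default ?size_tuple.
  have lt0 := ltnW lt1; rewrite (fE (Ordinal lt1)) (fE (Ordinal lt0)).
  exact: plam.
rewrite -fE; transitivity (\sum_(j <= i < n) (f i - f i.+1))%N.
  rewrite big_geq_mkord; apply: eq_bigr => i _.
  by rewrite mnmE -fE.
have : (j <= n)%N by rewrite ltnW.
move: f fn f_dec {fE} => f fn f_dec; move: (nat_of_ord j) => m; move: n fn => l fl le_ml.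
suffices <- : (\sum_(m <= i < l) (f i - f i.+1) + f l = f m)%N by rewrite fl addn0.
elim: l le_ml {fl} => [|l IHl].
  by rewrite leqn0 => /eqP->; rewrite big_geq.
rewrite leq_eqVlt => /orP[/eqP->|]; first by rewrite big_geq.
rewrite ltnS => le_ml; rewrite big_nat_recr //= -addnA subnK //.
exact: IHl.
Qed.

Definition lead_prod b (i : nat) : F := \prod_(j < n | (j <= i)%N) b j j.

(** The product of the leading products lead_prod b i, with the gaps of lam as
    exponents, is diag_pow b lam since the gaps from j on add up to lam_j. *)
Lemma exists_semi_invariant lam (f : 'I_n -> 'M[F]_n -> F) : is_partition lam ->
    (forall i, polyfun (f i)) ->
    (forall i b g, is_trig_mx b -> b \in unitmx ->
      f i (b *m g) = lead_prod b i ^+ mnm_gaps lam i * f i g) ->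
  exists2 P, semi_invariant lam P & forall g, mxeval P g = \prod_i f i g.
Proof.
move=> plam pf semif.
have [P PE] : polyfun (fun g => \prod_i f i g) by apply: polyfun_prod.
exists P => [b g tb ub|g]; last by rewrite PE.
rewrite -!PE; under eq_bigr do rewrite semif //.
rewrite big_split /=; congr (_ * _).
transitivity (\prod_(i < n) \prod_(j < n | (j <= i)%N) b j j ^+ mnm_gaps lam i).
  by apply: eq_bigr => i _; rewrite -prodrXl.
rewrite (exchange_big_dep xpredT) //=; apply: eq_bigr => j _.
by rewrite prodrXr sum_gaps.
Qed.

Lemma polyfun_trunc (phi : 'M[F]_n -> 'M[F]_n) C i :
  (forall j k, polyfun (fun g => phi g j k)) ->
  forall j k, polyfun (fun g => trunc C i (phi g) j k).
Proof.
move=> pphi j k; case jk: ((j < i) && (k < i))%N.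
  by apply: eq_polyfun (pphi j k) => g; rewrite mxE jk.
by apply: eq_polyfun (polyfun_const _ (C j k)) => g; rewrite mxE jk.
Qed.

Lemma polyfun_tr (phi : 'M[F]_n -> 'M[F]_n) :
  (forall j k, polyfun (fun g => phi g j k)) ->
  forall j k, polyfun (fun g => (phi g)^T j k).
Proof. by move=> pphi j k; apply: eq_polyfun (pphi k j) => g; rewrite mxE. Qed.

Lemma polyfun_congr C : forall j k, polyfun (fun g => (g *m C *m g^T) j k).
Proof.
apply: polyfun_mulmx => [|j k].
  apply: polyfun_mulmx => [|j k]; first exact: polyfun_entry.
  exact: polyfun_const.
by apply: polyfun_tr; apply: polyfun_entry.
Qed.

(** C is block diagonal, with a first block of size i. *)
Definition split_at (i : nat) C : Prop :=
  forall j k : 'I_n, (j < i)%N != (k < i)%N -> C j k = 0.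

Lemma split_at1 i : split_at i 1%:M.
Proof. by move=> j k ne; rewrite mxE; case: eqP => // eq_jk; rewrite eq_jk eqxx in ne. Qed.

Lemma trunc_tr C i A : (trunc C i A)^T = trunc C^T i A^T.
Proof. by apply/matrixP => j k; rewrite !mxE andbC. Qed.

(** Row j of b *m A involves the rows of A of index at most j. *)
Lemma trunc_trig_mul C i b A : is_trig_mx b -> split_at i C ->
  trunc 1%:M i b *m trunc C i A = trunc C i (b *m A).
Proof.
move=> /is_trig_mxP tb spC; apply/matrixP => j k; rewrite mxE [RHS]mxE.
case: (ltnP j i) => [ltji|leij] /=; last first.
  rewrite (bigD1 j) //= big1 ?addr0 => [|l ne].
    by rewrite !mxE ltnNge leij /= eqxx mul1r.
  by rewrite !mxE ltnNge leij /= eq_sym (negPf ne) mul0r.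
have bE l : trunc 1%:M i b j l = b j l.
  rewrite mxE ltji /=; case: ltnP => // leil; have ltjl := leq_trans ltji leil.
  by rewrite tb // mxE -val_eqE ltn_eqF.
case: (ltnP k i) => [ltki|leik].
  rewrite mxE; apply: eq_bigr => l _; rewrite bE mxE ltki andbT.
  by case: ltnP => // leil; rewrite tb ?mul0r // (leq_trans ltji).
rewrite spC ?ltji ?ltnNge ?leik // big1 // => l _; rewrite bE mxE.
rewrite [(k < i)%N]ltnNge leik andbF.
case: (ltnP l i) => [ltli|leil]; first by rewrite spC ?mulr0 // ltli ltnNge leik.
by rewrite tb ?mul0r // (leq_trans ltji).
Qed.

Lemma trunc_congr C i b A : is_trig_mx b -> split_at i C ->
  trunc C i (b *m A *m b^T) = trunc 1%:M i b *m trunc C i A *m (trunc 1%:M i b)^T.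
Proof.
move=> tb spC; rewrite trunc_trig_mul //.
apply: trmx_inj; rewrite trmx_mul trmxK !trunc_tr trunc_trig_mul ?trmx_mul ?trmxK //.
by move=> j k ne; rewrite mxE spC // eq_sym.
Qed.

Lemma det_trunc_trig i b : is_trig_mx b -> \det (trunc 1%:M i.+1 b) = lead_prod b i.
Proof.
move=> /is_trig_mxP tb; rewrite det_trig; last first.
  by apply/is_trig_mxP => j k ltjk; rewrite mxE tb // mxE -val_eqE ltn_eqF // if_same.
rewrite [RHS]big_mkcond /=; apply: eq_bigr => j _.
by rewrite mxE !ltnS andbb mxE eqxx.
Qed.

Lemma lead_prod_full b : is_trig_mx b -> (0 < n)%N -> lead_prod b n.-1 = \det b.
Proof.
move=> tb n_gt0; rewrite det_trig // [LHS]big_mkcond /=; apply: eq_bigr => j _.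
by rewrite -ltnS prednK ?ltn_ord.
Qed.

End SemiInvariants.

(** * Invariants of the classical groups in an irreducible module *)

Section ClassicalInvariants.
Variables (F : numClosedFieldType) (n : nat) (V : vectType F).
Variable a : 'M[F]_n -> 'End(V).
Hypotheses (act_a : is_action a) (pol_a : is_polynomial_action a).
Variables (U : {vspace V}) (lam : 'X_{1..n}).
Hypotheses (irrU : gl_irreducible a U) (plam : is_partition lam).
Hypothesis hwU : has_highest_weight a U lam.

Lemma dim_invariants (K : pred 'M[F]_n) (p : 'M[F]_n) (c : bool) :
    p \in unitmx -> (forall k, K k -> k \in unitmx) -> triangular_dense K p ->
    (c -> exists f, [/\ semi_invariant lam f, f != 0 &
      forall k g, K k -> mxeval f (g *m k) = mxeval f g]) ->
    (~~ c -> exists t : 'rV[F]_n, [/\ forall i, t 0 i != 0,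
      K (invmx p *m diag_mx t *m p) & tpow t lam != 1]) ->
  \dim (U :&: invariants a K) = c.
Proof.
move=> up uK dense existsf nocond.
have [h form_h] := exists_inv_form act_a pol_a.
have [v [vU v_neq0 v_unip v_torus]] := hwU.
have inv_torus := invariant_torus act_a pol_a form_h irrU vU v_neq0 v_unip v_torus up uK dense.
have le1 := dim_invariants_le1 act_a pol_a form_h irrU vU v_neq0 v_unip v_torus up uK dense.
case: c existsf nocond => [/(_ isT) [f [semif f_neq0 invf]] _|_ /(_ isT) [t [t_neq0 Kt tlam]]].
  have [u [uU invu u_neq0]] := exists_invariant act_a pol_a form_h irrU vU v_neq0
    v_unip v_torus semif f_neq0 uK invf.
  apply/eqP; rewrite eqn_leq le1 lt0n dimv_eq0 -vpick0.
  apply: contra u_neq0; rewrite vpick0 => /eqP X0; rewrite -memv0 -X0 memv_cap uU.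
  by apply/invariantsP.
apply/eqP; rewrite dimv_eq0 -subv0; apply/subvP => u /memv_capP[uU /invariantsP invu].
rewrite memv0; apply: contraR tlam => u_neq0.
by rewrite (inv_torus u t).
Qed.

Section Orthogonal.
Hypothesis n_gt0 : (0 < n)%N.

Lemma orthogonal_unit (k : 'M[F]_n) : orthogonal_group k -> k \in unitmx.
Proof. by move=> /eqP kk; have [] := mulmx1_unit kk. Qed.

Lemma orthogonal_det (k : 'M[F]_n) : k^T *m k = 1%:M -> (\det k == 1) || (\det k == -1).
Proof.
move=> kk; have := congr1 determinant kk; rewrite det_mulmx det_tr det1 -expr2.
by move/eqP; rewrite sqrf_eq1.
Qed.

(** If g *m g^T = b *m b^T then b^-1 *m g is orthogonal.  When its determinant is -1,
    a sign is moved from it to b. *)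
Lemma so_dense : triangular_dense (@special_orthogonal_group F n) 1%:M.
Proof.
exists (fun g => \prod_(i < n.+1) \det (trunc 1%:M i (g *m 1%:M *m g^T))), 1%:M; split.
- apply: polyfun_prod => i _; apply: polyfun_det.
  by apply: polyfun_trunc; apply: polyfun_congr.
- by rewrite big1 ?oner_neq0 // => i _; rewrite !(mulmx1, trmx1) trunc_id det1.
move=> g /prodf_neq0 q_neq0; rewrite mulmx1 in q_neq0 *.
have [||b tb ggE] := @cholesky _ _ (g *m g^T).
- by rewrite trmx_mul trmxK.
- by move=> i lein; have := q_neq0 (inord i) isT; rewrite inordK.
have ub : b \in unitmx.
  have := q_neq0 ord_max isT; rewrite /= trunc_full ggE det_mulmx det_tr mulf_eq0.
  by rewrite orbb unitmxE unitfE.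
pose k := invmx b *m g.
have kk : k^T *m k = 1%:M.
  apply: mulmx1C; rewrite /k trmx_mul mulmxA -[_ *m g *m _]mulmxA ggE.
  by rewrite mulmxA mulVmx // mul1mx trmx_inv mulmxV // unitmx_tr.
have gE : g = b *m k by rewrite /k mulKVmx.
case/orP: (orthogonal_det kk) => /eqP dk.
  exists b, k; split; rewrite ?mulmx1 //.
  by apply/andP; rewrite kk dk !eqxx.
pose d : 'M[F]_n := diag_mx (\row_j (if (j == 0 :> nat)%N then -1 else 1)).
have dd : d *m d = 1%:M.
  rewrite /d mulmx_diag -diag_const_mx; congr diag_mx; apply/rowP => j.
  by rewrite !mxE; case: ifP => _; rewrite ?mulrNN mulr1.
have det_d : \det d = -1.
  rewrite det_diag (bigD1 (Ordinal n_gt0)) //= mxE eqxx big1 ?mulr1 // => j ne.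
  by rewrite mxE -[0%N]/(val (Ordinal n_gt0)) val_eqE (negPf ne).
have dT : d^T = d by rewrite tr_diag_mx.
exists (b *m d), (d *m k); split.
- apply/is_trig_mxP => i j ltij; rewrite mul_mx_diag mxE.
  by rewrite (is_trig_mxP tb) // mul0r.
- by rewrite unitmx_mul ub unitmxE det_d unitrN1.
- apply/andP; rewrite trmx_mul dT mulmxA -[_ *m d *m d]mulmxA dd mulmx1 kk eqxx.
  by rewrite det_mulmx det_d dk mulrNN mulr1 eqxx.
- by rewrite mulmx1 mulmxA -[b *m d *m d]mulmxA dd mulmx1.
Qed.

Lemma o_dense : triangular_dense (@orthogonal_group F n) 1%:M.
Proof.
have [q [g0 [pq q0 qE]]] := so_dense; exists q, g0; split=> // g /qE.
by move=> [b [k [tb ub /andP[kk _] gE]]]; exists b, k.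
Qed.

(** For the last index the power of det g is allowed to be odd, as det is itself
    invariant under SO(n); the other exponents are those of leading minors of
    g g^T, which are multiplied by the square of lead_prod b i. *)
Definition orth_factor (i : 'I_n) (g : 'M[F]_n) : F :=
  if (i.+1 == n)%N then \det g ^+ mnm_gaps lam i
  else \det (trunc 1%:M i.+1 (g *m 1%:M *m g^T)) ^+ (mnm_gaps lam i)./2.

Lemma exists_orth_semi_invariant :
    (forall i : 'I_n, (i.+1 < n)%N -> ~~ odd (mnm_gaps lam i)) ->
  exists f, [/\ semi_invariant lam f, f != 0 &
    forall g, mxeval f g = \prod_i orth_factor i g].
Proof.
move=> even_gap; have [|i b g tb ub|f semif fE] := exists_semi_invariant (f := orth_factor) plam.
- move=> i; rewrite /orth_factor; case: (i.+1 == n)%N; apply: polyfunX; apply: polyfun_det.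
    exact: polyfun_entry.
  by apply: polyfun_trunc; apply: polyfun_congr.
- rewrite /orth_factor; case: eqP => [iE|/eqP ne].
    rewrite det_mulmx exprMn -(lead_prod_full tb) //.
    by have -> : n.-1 = i by rewrite -[in LHS]iE.
  have lt_in : (i.+1 < n)%N by rewrite ltn_neqAle ne ltn_ord.
  rewrite !mulmx1 trmx_mul mulmxA -[b *m g *m g^T]mulmxA trunc_congr //; last exact: split_at1.
  rewrite !det_mulmx det_tr (det_trunc_trig _ tb) mulrAC -expr2 exprMn -exprM mul2n.
  by rewrite even_halfK ?even_gap.
exists f; split=> //; apply/eqP => f0; have := fE 1%:M.
rewrite f0 /mxeval meval0 big1 => [/eqP|i _]; first by rewrite eq_sym oner_eq0.
by rewrite /orth_factor !(mulmx1, trmx1) trunc_id det1 !expr1n if_same.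
Qed.

Lemma orth_factor_inv (i : 'I_n) (g k : 'M[F]_n) :
    k^T *m k = 1%:M -> (i.+1 == n)%N ==> (\det k ^+ mnm_gaps lam i == 1) ->
  orth_factor i (g *m k) = orth_factor i g.
Proof.
move=> kk; rewrite /orth_factor; case: ifP => _ /= => [/eqP dk|_].
  by rewrite det_mulmx exprMn dk mulr1.
by rewrite !mulmx1 trmx_mul mulmxA -[g *m k *m _]mulmxA (mulmx1C kk) mulmx1.
Qed.

(** If lam_i - lam_(i+1) is odd, changing the sign of the coordinates i and i + 1
    is an element of SO(n) that multiplies the highest weight vector by -1. *)
Lemma dim_special_orthogonal_invariants :
  \dim (U :&: invariants a (@special_orthogonal_group F n)) =
  [forall i : 'I_n, (i.+1 < n)%N ==> ~~ odd (mnm_gaps lam i)].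
Proof.
apply: dim_invariants so_dense _ _; first exact: unitmx1.
- by move=> k /andP[/orthogonal_unit].
- move=> /forallP even_gap.
  have [i lt_in|f [semif f_neq0 fE]] := exists_orth_semi_invariant.
    exact: (implyP (even_gap i)).
  exists f; split=> // k g /andP[/eqP kk /eqP dk]; rewrite !fE.
  apply: eq_bigr => i _; apply: orth_factor_inv => //.
  by rewrite dk expr1n eqxx implybT.
rewrite negb_forall => /existsP[ i]; rewrite negb_imply negbK => /andP[lt_in odd_gap].
pose i' := Ordinal lt_in; have lt_ii' : (i < i')%N by [].
have ne : i' != i by rewrite -val_eqE gtn_eqF.
pose t : 'rV[F]_n := \row_j (if (j == i) || (j == i') then -1 else 1).
have tE (m : 'I_n -> nat) : \prod_j t 0 j ^+ m j = (-1) ^+ (m i + m i').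
  rewrite (bigD1 i) //= (bigD1 i') //= big1 ?mulr1 => [|j /andP[ji ji']].
    by rewrite !mxE !eqxx orbT exprD.
  by rewrite mxE (negPf ji) (negPf ji') expr1n.
exists t; split=> [j||].
- by rewrite mxE; case: ifP; rewrite ?oppr_eq0 oner_neq0.
- rewrite invmx1 mul1mx mulmx1; apply/andP; rewrite tr_diag_mx mulmx_diag; split.
    apply/eqP; rewrite -diag_const_mx; congr diag_mx; apply/rowP => j.
    by rewrite !mxE; case: ifP => _; rewrite ?mulrNN mulr1.
  have det_t : \prod_j t 0 j ^+ 1 = 1 by rewrite (tE (fun=> 1%N)) -signr_odd expr0.
  by rewrite det_diag; apply/eqP.
- rewrite /tpow tE; have le_lam : (lam i' <= lam i)%N by apply: plam; apply: ltnW.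
  have gapE : mnm_gaps lam i = (lam i - lam i')%N by rewrite mnmE [lam i'](mnm_nth 0%N).
  rewrite gapE oddB // in odd_gap; rewrite -signr_odd oddD odd_gap expr1.
  by rewrite eq_sym -subr_eq0 opprK (_ : 1 + 1 = 2%:R) // pnatr_eq0.
Qed.

Lemma dim_orthogonal_invariants :
  \dim (U :&: invariants a (@orthogonal_group F n)) =
  [forall i : 'I_n, ~~ odd (lam i)].
Proof.
apply: dim_invariants o_dense _ _; [exact: unitmx1 | exact: orthogonal_unit | |].
- move=> /forallP even_lam.
  have [i lt_in|f [semif f_neq0 fE]] := exists_orth_semi_invariant.
    rewrite mnmE -[nth _ _ _](mnm_nth 0%N lam (Ordinal lt_in)) oddB ?(negPf (even_lam i)).
      by rewrite (negPf (even_lam _)).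
    exact: plam.
  exists f; split=> // k g /eqP kk; rewrite !fE.
  apply: eq_bigr => i _; apply: orth_factor_inv => //; apply/implyP => /eqP iE.
  have -> : mnm_gaps lam i = lam i by rewrite mnmE nth_default ?size_tuple ?iE ?subn0.
  case/orP: (orthogonal_det kk) => /eqP->; first by rewrite expr1n.
  by rewrite -signr_odd (negPf (even_lam i)).
rewrite negb_forall => /existsP[ i]; rewrite negbK => odd_lam.
pose t : 'rV[F]_n := \row_j (if j == i then -1 else 1).
exists t; split=> [j||].
- by rewrite mxE; case: ifP; rewrite ?oppr_eq0 oner_neq0.
- rewrite invmx1 mul1mx mulmx1; apply/eqP; rewrite tr_diag_mx mulmx_diag.
  rewrite -diag_const_mx; congr diag_mx; apply/rowP => j.
  by rewrite !mxE; case: ifP => _; rewrite ?mulrNN mulr1.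
- rewrite /tpow (bigD1 i) //= big1 ?mulr1 => [|j ne]; last by rewrite mxE (negPf ne) expr1n.
  rewrite mxE eqxx -signr_odd odd_lam expr1.
  by rewrite eq_sym -subr_eq0 opprK (_ : 1 + 1 = 2%:R) // pnatr_eq0.
Qed.

End Orthogonal.

End ClassicalInvariants.

Section Symplectic.
Variables (F : numClosedFieldType) (k : nat).
Implicit Types g A : 'M[F]_(k + k).

Let J : 'M[F]_(k + k) := std_form F k.
Let J' : 'M[F]_(k + k) := alt_form F (k + k).

Lemma symplectic_form_std : symplectic_form F (k + k) = J.
Proof.
have half : (k + k)./2 = k by rewrite addnn doubleK.
apply/matrixP => i j; rewrite mxE half.
case: (split_ordP i) => i' ->; case: (split_ordP j) => j' ->.
- rewrite block_mxEul mxE /= !ltn_eqF ?subrr //.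
    by rewrite (leq_trans (ltn_ord i')) ?leq_addl.
  by rewrite (leq_trans (ltn_ord j')) ?leq_addl.
- rewrite block_mxEur mxE /= [(i' == _ :> nat)]ltn_eqF ?subr0; last first.
    by rewrite (leq_trans (ltn_ord i')) ?leq_addl.
  by rewrite addnC eqn_add2r eq_sym val_eqE.
- rewrite block_mxEdl !mxE /= [(j' == _ :> nat)]ltn_eqF ?sub0r; last first.
    by rewrite (leq_trans (ltn_ord j')) ?leq_addl.
  by rewrite addnC eqn_add2r val_eqE.
- rewrite block_mxEdr mxE /= !ltn_eqF ?subrr // -addnA ltn_add2l.
    by rewrite (leq_trans (ltn_ord i')) ?leq_addl.
  by rewrite (leq_trans (ltn_ord j')) ?leq_addl.
Qed.

Lemma std_form_sq : J *m J = - 1%:M.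
Proof.
rewrite /J /std_form mulmx_block !mulmx0 !mul0mx !mul1mx !addr0 !add0r mulmx1.
by rewrite scalar_mx_block opp_block_mx oppr0.
Qed.

Lemma std_form_tr : J^T = - J.
Proof.
by rewrite /J /std_form tr_block_mx opp_block_mx !trmx0 linearN /= !trmx1 !oppr0 opprK.
Qed.

Lemma symplectic_tr g : g *m J *m g^T = J -> g^T *m J *m g = J.
Proof.
move=> gJg; have : g *m (- (J *m g^T *m J)) = 1%:M.
  by rewrite mulmxN !mulmxA gJg std_form_sq opprK.
move/mulmx1C; rewrite mulNmx => /(congr1 (mulmx J)).
rewrite mulmxN mulmx1 !mulmxA std_form_sq mulNmx mul1mx !mulNmx opprK.
exact.
Qed.

Let half_lt (i : 'I_(k + k)) : (i./2 < k)%N.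
Proof. by rewrite ltn_half_double -addnn. Qed.

(** The permutation 2j |-> j, 2j + 1 |-> k + j, which takes the block diagonal form
    to the standard one. *)
Definition unpair (i : 'I_(k + k)) : 'I_(k + k) :=
  if odd i then rshift k (Ordinal (half_lt i)) else lshift k (Ordinal (half_lt i)).

Lemma unpair_inj : injective unpair.
Proof.
move=> i j; rewrite /unpair; case: ifP => oi; case: ifP => oj /eqP;
  rewrite ?eq_rlshift ?eq_lrshift // ?(inj_eq (@rshift_inj _ _)) ?(inj_eq (@lshift_inj _ _));
  move=> /eqP/(congr1 val) /= half_eq; apply: val_inj;
  by rewrite /= -[LHS]odd_double_half -[RHS]odd_double_half oi oj half_eq.
Qed.

Definition unpair_mx : 'M[F]_(k + k) := \matrix_(i, j) (unpair i == j)%:R.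

Let P := unpair_mx.

Lemma unpair_mxE A i j : (P *m A *m P^T) i j = A (unpair i) (unpair j).
Proof.
rewrite mxE (bigD1 (unpair j)) //= big1 ?addr0 => [|l ne]; last first.
  by rewrite [_^T _ _]mxE [P _ _]mxE eq_sym (negPf ne) mulr0.
rewrite [_^T _ _]mxE [P _ _]mxE eqxx mulr1 mxE (bigD1 (unpair i)) //= big1 ?addr0 => [|l ne].
  by rewrite mxE eqxx mul1r.
by rewrite mxE eq_sym (negPf ne) mul0r.
Qed.

Lemma unpair_mx_orth : P *m P^T = 1%:M.
Proof.
rewrite -{1}[P]mulmx1; apply/matrixP => i j; rewrite unpair_mxE !mxE.
by rewrite (inj_eq unpair_inj).
Qed.

Lemma unpair_mx_orth' : P^T *m P = 1%:M.
Proof. exact: mulmx1C unpair_mx_orth. Qed.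

Lemma unpair_mx_form : P *m J *m P^T = J'.
Proof.
apply/matrixP => i j; rewrite unpair_mxE [RHS]mxE /unpair /J /std_form.
have iE := odd_double_half i; have jE := odd_double_half j.
case oi: (odd i) iE => iE; case oj: (odd j) jE => jE /=; rewrite ?andbF ?subr0 ?sub0r.
- by rewrite block_mxEdr mxE.
- rewrite block_mxEdl !mxE -val_eqE /= -[in RHS]iE -[in RHS]jE add0n add1n eqSS.
  by rewrite (inj_eq double_inj).
- rewrite block_mxEur !mxE -val_eqE /= -[in RHS]iE -[in RHS]jE add0n add1n eqSS.
  by rewrite (inj_eq double_inj) eq_sym.
- rewrite block_mxEul mxE -[in RHS]iE -[in RHS]jE !add0n.
  have parity l m : (l.*2 == m.*2.+1) = false.
    by apply/negP => /eqP/(congr1 odd); rewrite /= !odd_double.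
  by rewrite !parity subrr.
Qed.

Lemma alt_form_unit : J' \in unitmx.
Proof.
have uJ : J \in unitmx.
  have : J *m (- J) = 1%:M by rewrite mulmxN std_form_sq opprK.
  by case/mulmx1_unit.
by rewrite -unpair_mx_form !unitmx_mul uJ unitmx_tr; case/mulmx1_unit: unpair_mx_orth => ->.
Qed.

Lemma split_at_alt_form i : ~~ odd i -> split_at i J'.
Proof.
move=> ei; suffices lt_case (j l : 'I_(k + k)) : (j < i <= l)%N -> J' j l = 0 /\ J' l j = 0.
  move=> j l; case: (ltnP j i) => ji; case: (ltnP l i) => li // _.
    by case: (lt_case j l) => //; rewrite ji.
  by case: (lt_case l j) => //; rewrite li.
move=> /andP[ji il].
have jl : (j == l.+1 :> nat) = false by rewrite ltn_eqF // ltnS ltnW // (leq_trans ji).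
have lj : ~~ odd j && (l == j.+1 :> nat) = false.
  apply/negP => /andP[ej /eqP lE]; have iE : i = j.+1.
    by apply/eqP; rewrite eqn_leq ji -lE il.
  by rewrite iE /= ej in ei.
by rewrite !mxE jl lj !andbF subrr.
Qed.

Lemma symplectic_unit g : symplectic_group g -> g \in unitmx.
Proof.
rewrite /symplectic_group /= symplectic_form_std => /eqP gJg.
have : - (J *m g^T *m J) *m g = 1%:M.
  rewrite mulNmx -!mulmxA [g^T *m _]mulmxA gJg; exact: (canLR (@opprK _)) std_form_sq.
by case/mulmx1_unit.
Qed.

(** If g J g^T = b J' b^T and P J P^T = J', then (b P)^-1 g preserves J. *)
Lemma symplectic_dense : triangular_dense (@symplectic_group F (k + k)) P.
Proof.
exists (fun g => \prod_(i < (k + k).+1 | ~~ odd i) \det (trunc J' i (g *m J *m g^T))), P; split.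
- apply: polyfun_prod => i _; apply: polyfun_det.
  by apply: polyfun_trunc; apply: polyfun_congr.
- apply/prodf_neq0 => i _; rewrite unpair_mx_form trunc_id -unitfE -unitmxE.
  exact: alt_form_unit.
move=> g /prodf_neq0 q_neq0.
have even_n : ~~ odd (k + k) by rewrite addnn odd_double.
have [||b tb gE] := @alternating_factorization _ _ (g *m J *m g^T) even_n.
- by rewrite !trmx_mul trmxK std_form_tr mulNmx mulmxN mulmxA.
- by move=> i lein ei; have := q_neq0 (inord i); rewrite inordK //; apply.
have ub : b \in unitmx.
  have := q_neq0 ord_max even_n; rewrite /= trunc_full gE !det_mulmx !mulf_eq0 !negb_or.
  by rewrite unitmxE unitfE => /andP[/andP[]].
have uP : P \in unitmx by case/mulmx1_unit: unpair_mx_orth.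
have ubP : b *m P \in unitmx by rewrite unitmx_mul ub.
exists b, (invmx (b *m P) *m g); split=> //; last by rewrite mulKVmx.
rewrite /symplectic_group /= symplectic_form_std; apply/eqP/symplectic_tr.
set c := b *m P in ubP *.
have -> : invmx c *m g *m J *m (invmx c *m g)^T = invmx c *m (g *m J *m g^T) *m invmx c^T.
  by rewrite trmx_mul trmx_inv !mulmxA.
have -> : g *m J *m g^T = c *m J *m c^T.
  by rewrite gE /c trmx_mul -/J' -unpair_mx_form !mulmxA.
rewrite -[c *m J *m _]mulmxA mulKmx // mulmxK // unitmx_tr //.
Qed.

Variables (V : vectType F) (a : 'M[F]_(k + k) -> 'End(V)).
Hypotheses (act_a : is_action a) (pol_a : is_polynomial_action a).
Variables (U : {vspace V}) (lam : 'X_{1..k + k}).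
Hypotheses (irrU : gl_irreducible a U) (plam : is_partition lam).
Hypothesis hwU : has_highest_weight a U lam.

(** The factors are Pfaffians of leading blocks of even size of g J g^T, in the
    order of coordinates for which the padding J' becomes J.  If lam_i > lam_(i+1)
    for an even index i, counted from 0, the matrix with entries 2 and 1/2 at i and i + 1 preserves J' and
    does not fix the highest weight vector. *)
Lemma dim_symplectic_invariants :
  \dim (U :&: invariants a (@symplectic_group F (k + k))) =
  [forall i : 'I_(k + k), ~~ odd i ==> (mnm_gaps lam i == 0%N)].
Proof.
have uP : P \in unitmx by case/mulmx1_unit: unpair_mx_orth.
have PV : invmx P = P^T by rewrite -[LHS]mul1mx -unpair_mx_orth' mulmxK.
apply: (dim_invariants act_a pol_a irrU hwU uP symplectic_unit symplectic_dense).
  move=> /forallP gap0.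
  pose f (i : 'I_(k + k)) g : F := if odd i then
    pfaff (P^T *m trunc J' i.+1 (g *m J *m g^T) *m P) ^+ mnm_gaps lam i else 1.
  have [i|i b g tb ub|Q semiQ QE] := exists_semi_invariant (f := f) plam.
  - rewrite /f; case: (odd i); last exact: polyfun_const.
    apply: polyfunX; apply: polyfun_sum => s _.
    apply: polyfunM; first exact: polyfun_const.
    apply: polyfun_prod => j _; apply: polyfun_mulmx => [|j1 j2]; last exact: polyfun_const.
    apply: polyfun_mulmx => [j1 j2|]; first exact: polyfun_const.
    by apply: polyfun_trunc; apply: polyfun_congr.
  - rewrite /f; case oi: (odd i); last first.
      by have := gap0 i; rewrite oi /= => /eqP->; rewrite expr0 mulr1.
    rewrite -exprMn; congr (_ ^+ _).
    have -> : b *m g *m J *m (b *m g)^T = b *m (g *m J *m g^T) *m b^T.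
      by rewrite trmx_mul !mulmxA.
    rewrite trunc_congr //; last by apply: split_at_alt_form; rewrite /= oi.
    set T := trunc 1%:M _ b; set Y := trunc J' _ _.
    have -> : P^T *m (T *m Y *m T^T) *m P =
        (P^T *m T *m P) *m (P^T *m Y *m P) *m (P^T *m T *m P)^T.
      rewrite !trmx_mul trmxK !mulmxA; congr (_ *m _).
      by rewrite -[_ *m P *m P^T]mulmxA unpair_mx_orth mulmx1
        -[_ *m P *m P^T]mulmxA unpair_mx_orth mulmx1.
    rewrite pfaff_congr; congr (_ * _).
    rewrite !det_mulmx mulrAC -det_mulmx unpair_mx_orth' det1 mul1r.
    exact: det_trunc_trig.
  exists Q; split=> //.
    apply/eqP => Q0; have := QE P; rewrite Q0 /mxeval meval0 => /esym/eqP.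
    rewrite prodf_seq_eq0 => /hasP[ i _]; rewrite /f /=; case: (odd i); last by rewrite oner_eq0.
    rewrite expf_eq0 => /andP[_]; rewrite unpair_mx_form trunc_id -unpair_mx_form !mulmxA.
    rewrite unpair_mx_orth' mul1mx -mulmxA unpair_mx_orth' mulmx1.
    by rewrite (negPf (pfaff_std_neq0 F k)).
  move=> c g; rewrite /symplectic_group /= symplectic_form_std => /eqP cJc.
  have cJc' : c *m J *m c^T = J by have := @symplectic_tr c^T; rewrite trmxK; apply.
  rewrite !QE; apply: eq_bigr => i _; rewrite /f.
  have -> // : g *m c *m J *m (g *m c)^T = g *m J *m g^T.
  by rewrite trmx_mul -{2}cJc' !mulmxA.
rewrite negb_forall => /existsP[ i]; rewrite negb_imply => /andP[ei gap_neq0].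
have lt_i' : (i.+1 < k + k)%N.
  rewrite ltn_neqAle ltn_ord andbT; apply/eqP => iE.
  by have := odd_double k; rewrite -addnn -iE /= ei.
pose i' := Ordinal lt_i'; have ne : i' != i by rewrite -val_eqE gtn_eqF.
pose t : 'rV[F]_(k + k) :=
  \row_j (if j == i then 2%:R else if j == i' then 2%:R^-1 else 1).
have two_neq0 : 2%:R != 0 :> F by rewrite pnatr_eq0.
have t_neq0 j : t 0 j != 0.
  by rewrite mxE; case: ifP => // _; case: ifP => _; rewrite ?invr_eq0 ?oner_neq0.
exists t; split=> //.
- rewrite /symplectic_group /= symplectic_form_std; apply/eqP/symplectic_tr.
  rewrite PV !trmx_mul trmxK tr_diag_mx.
  have -> : P^T *m diag_mx t *m P *m J *m (P^T *m (diag_mx t *m P)) =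
      P^T *m (diag_mx t *m (P *m J *m P^T) *m diag_mx t) *m P by rewrite !mulmxA.
  rewrite unpair_mx_form.
  suffices -> : diag_mx t *m J' *m diag_mx t = J'.
    rewrite -unpair_mx_form !mulmxA unpair_mx_orth' mul1mx.
    by rewrite -mulmxA unpair_mx_orth' mulmx1.
  rewrite mul_mx_diag mul_diag_mx.
  have t_pair (j l : 'I_(k + k)) : ~~ odd j && (l == j.+1 :> nat) -> t 0 j * t 0 l = 1.
    move=> /andP[ej /eqP lE]; rewrite !mxE.
    have -> : (j == i') = false.
      by apply/negP => /eqP/(congr1 val) /= jE; rewrite jE /= ei in ej.
    have -> : (l == i) = false.
      by apply/negP => /eqP/(congr1 val) /= liE; rewrite -liE lE /= ej in ei.
    rewrite -!val_eqE /= lE eqSS; case: eqP => _; last by rewrite mulr1.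
    by rewrite divff.
  apply/matrixP => j l; rewrite !mxE -![if _ then _ else _]/(_).
  have [jl|njl] := boolP (~~ odd j && (l == j.+1 :> nat)).
    have -> : ~~ odd l && (j == l.+1 :> nat) = false.
      by case/andP: jl => ej /eqP->; rewrite /= ej.
    by have := t_pair j l jl; rewrite !mxE subr0 mulr1.
  have [lj|nlj] := boolP (~~ odd l && (j == l.+1 :> nat)).
    by have := t_pair l j lj; rewrite !mxE sub0r mulrN1 mulNr [X in - X]mulrC => ->.
  by rewrite subrr mulr0 mul0r.
- have le_lam : (lam i' <= lam i)%N by apply: plam; apply: leqnSn.
  have gapE : mnm_gaps lam i = (lam i - lam i')%N by rewrite mnmE [lam i'](mnm_nth 0%N).
  rewrite /tpow (bigD1 i) //= (bigD1 i') //= big1 ?mulr1 => [|j /andP[ji ji']]; last first.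
    by rewrite mxE (negPf ji) (negPf ji') expr1n.
  rewrite !mxE eqxx (negPf ne) eqxx exprVn -expfB_cond; last by rewrite (negPf two_neq0).
  rewrite -gapE -natrX -[1]/(1%:R) eqr_nat.
  by rewrite -[X in _ != X](expn0 2) eqn_exp2l.
Qed.

End Symplectic.

(** * Multiplicity series *)

Lemma sum_highest_weights (T : eqType) (s : seq T) (c : T -> nat) :
  (\sum_(x <- s) c x = \sum_(x <- undup s) count_mem x s * c x)%N.
Proof.
rewrite -[LHS]big_undup_iterop_count; apply: eq_bigr => x _.
by rewrite Monoid.iteropE iter_addn_0 mulnC.
Qed.

Lemma dim_invariants_sum (F : numClosedFieldType) n (V : vectType F)
    (a : 'M[F]_n -> 'End(V)) (G : pred 'M[F]_n) (c : 'X_{1..n} -> bool) s :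
    (forall k, G k -> k \in unitmx) -> is_decomposition a s ->
    (forall U lam, gl_irreducible a U -> is_partition lam -> has_highest_weight a U lam ->
      \dim (U :&: invariants a G) = c lam) ->
  \dim (invariants a G) = (\sum_(lam <- undup s) count_mem lam s * c lam)%N.
Proof.
move=> uG [U [dirU sumU goodU]] dimE.
pose X i := (U i :&: invariants a G)%VS.
have indep : forall u, (forall i, u i \in U i) -> \sum_i u i = 0 -> forall i, u i = 0.
  move=> u uU u0 i; move/directv_sum_independent: dirU; apply=> // j _; exact: uU.
have sumX : (\sum_i X i)%VS = invariants a G.
  apply/eqP; rewrite eqEsubv; apply/andP; split.
    by apply/subv_sumP => i _; apply: capvSr.
  apply/subvP => v /invariantsP invv.
  have : v \in (\sum_i U i)%VS by rewrite sumU memvf.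
  case/memv_sumP => u uU vE; rewrite vE; apply: memv_sumr => i _.
  rewrite /X memv_cap uU //=; apply/invariantsP => g Gg; apply/eqP; rewrite -subr_eq0.
  apply/eqP; move: i; apply: indep => [i|].
    have [[_ stU _] _ _] := goodU i.
    by rewrite memvB ?stU ?uU ?uG.
  by rewrite sumrB -(linear_sum (a g)) -vE /= invv // subrr.
have dirX : directv (\sum_i X i)%VS.
  apply/directv_sum_independent => u uX u0 i _; apply: indep => // j.
  by have := uX j isT; rewrite /X memv_cap => /andP[].
rewrite -sumX (directvP dirX) /= -sum_highest_weights (big_tnth _ _ s).
apply: eq_bigr => i _; have [irrU plam hw] := goodU i; exact: dimE.
Qed.

Section HilbertSeries.
Variables (R : realType) (n : nat) (W : polyGLmod R n).

Lemma hilbert_invariants_sum (G : pred 'M[R[i]]_n) (c : 'X_{1..n} -> bool) l :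
    (forall k, G k -> k \in unitmx) ->
    (forall (V : vectType R[i]) (a : 'M[R[i]]_n -> 'End(V)) U lam,
      is_action a -> is_polynomial_action a ->
      gl_irreducible a U -> is_partition lam -> has_highest_weight a U lam ->
      \dim (U :&: invariants a G) = c lam) ->
  hilbert_invariants W G l = \sum_(lam <- sym_weights W l) (sym_mult W l lam * c lam)%:R.
Proof.
move=> uG dimE.
have act_a := sym_act_is_action (glact_action W) l.
have pol_a := sym_act_is_polynomial (glact_polynomial W) l.
have dec := epsilon_spec (inhabits [::]) _ (exists_decomposition act_a pol_a).
rewrite /hilbert_invariants (dim_invariants_sum (c := c) uG dec) ?natr_sum // => U lam.
exact: dimE.
Qed.

End HilbertSeries.

Section Substitution.
Variable n : nat.
Implicit Types (m : 'X_{1..n}) (p : {mpoly rat[n]}).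

(** The exponents left after substitution of constants for the first k variables. *)
Definition mnm_tail (k : nat) m := [multinom if (i < k)%N then 0%N else m i | i < n].

Lemma subst_var_const k c (M : nat -> {mpoly rat[n]}) p l :
  M l = p -> subst_var k c M l = subst_var k c (fun=> p) l.
Proof. by move=> <-. Qed.

Lemma subst_var_sum k c (s : seq 'X_{1..n}) (z : 'X_{1..n} -> rat)
    (f : 'X_{1..n} -> {mpoly rat[n]}) l :
  subst_var k c (fun=> \sum_(lam <- s) z lam *: f lam) l =
  \sum_(lam <- s) z lam *: subst_var k c (fun=> f lam) l.
Proof.
by rewrite /subst_var linear_sum /=; apply: eq_bigr => lam _; rewrite comp_mpolyZ.
Qed.

Lemma subst_var_mnm (k : 'I_n) c m l :
  subst_var k c (fun=> 'X_[mnm_tail k m]) l = c ^+ m k *: 'X_[mnm_tail k.+1 m].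
Proof.
rewrite /subst_var comp_mpolyX (bigD1 k) //= tnth_mktuple eqxx !mnmE ltnn.
rewrite -mul_mpolyC rmorphXn /=; congr (_ * _).
rewrite [RHS]mpolyXE_id [RHS](bigD1 k) //= mnmE ltnSn expr0 mul1r.
apply: eq_bigr => i ne; rewrite tnth_mktuple !mnmE eq_sym val_eqE (negPf ne).
by rewrite [in RHS]ltnS [in RHS]leq_eqVlt val_eqE (negPf ne).
Qed.

(** Averaging over the two signs kills odd powers and replaces even ones by 1. *)
Lemma iter_mean_sum (s : seq 'X_{1..n}) (z : 'X_{1..n} -> rat) (e : 'X_{1..n} -> 'X_{1..n})
    (M : nat -> {mpoly rat[n]}) l k :
  (k <= n)%N -> M l = \sum_(lam <- s) z lam *: 'X_[e lam] ->
  iter_mean M k l = \sum_(lam <- s)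
    (z lam * [forall i : 'I_n, (i < k)%N ==> ~~ odd (e lam i)]%:R) *: 'X_[mnm_tail k (e lam)].
Proof.
move=> + Ml; elim: k => [_|k IHk lt_kn].
  rewrite /= Ml; apply: eq_bigr => lam _.
  have -> : mnm_tail 0 (e lam) = e lam by apply/mnmP => i; rewrite mnmE.
  have -> : [forall i : 'I_n, (i < 0)%N ==> ~~ odd (e lam i)] by apply/forallP.
  by rewrite mulr1.
have meanE c : subst_var k c (iter_mean M k) l = \sum_(lam <- s)
    (z lam * [forall i : 'I_n, (i < k)%N ==> ~~ odd (e lam i)]%:R) *:
      (c ^+ e lam (Ordinal lt_kn) *: 'X_[mnm_tail k.+1 (e lam)]).
  rewrite (subst_var_const _ _ (IHk (ltnW lt_kn))) subst_var_sum.
  by apply: eq_bigr => lam _; rewrite (subst_var_mnm (Ordinal lt_kn)).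
rewrite /= !meanE -big_split scaler_sumr /=; apply: eq_bigr => lam _.
rewrite -scalerDr -scalerDl !scalerA; congr (_ *: _).
rewrite expr1n -signr_odd mulrCA -mulrA; congr (_ * _).
have forallS : [forall i : 'I_n, (i < k.+1)%N ==> ~~ odd (e lam i)] =
    [forall i : 'I_n, (i < k)%N ==> ~~ odd (e lam i)] && ~~ odd (e lam (Ordinal lt_kn)).
  apply/forallP/andP => [all_e|[/forallP all_e ek] i].
    split; last by have := all_e (Ordinal lt_kn); rewrite ltnSn.
    by apply/forallP => i; apply/implyP => lt_ik; apply: (implyP (all_e i)); rewrite ltnW.
  apply/implyP; rewrite ltnS leq_eqVlt => /predU1P[ik|lt_ik].
    by have -> : i = Ordinal lt_kn by apply: val_inj.
  exact: (implyP (all_e i)).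
rewrite forallS; case: (odd _); rewrite /= ?andbF ?andbT.
  by rewrite expr1 addNr !mulr0.
by rewrite expr0 (_ : 2%:R^-1 * (1 + 1) = 1) ?mulr1.
Qed.

End Substitution.

Theorem theorem4p1 (R : realType) (n : nat) (n_gt0 : (0 < n)%N)
    (W : polyGLmod R n) :
  [/\ forall k : nat, n = (2 * k)%N -> forall l : nat,
        hilbert_invariants W (@symplectic_group R[i] n) l =
        (mult_series' W l).@[fun i : 'I_n => if odd i then 1 else 0],
      forall l : nat,
        (hilbert_invariants W (@orthogonal_group R[i] n) l)%:MP =
        iter_mean (mult_series W) n l
    & forall l : nat,
        (hilbert_invariants W (@special_orthogonal_group R[i] n) l)%:MP =
        subst_var n.-1 1 (iter_mean (mult_series' W) n.-1) l].
Proof.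
split=> [k nE l|l|l].
- have {nE}nE : n = (k + k)%N by rewrite addnn -mul2n.
  subst n.
  rewrite (@hilbert_invariants_sum _ _ _ _
    (fun lam => [forall i : 'I_(k + k), ~~ odd i ==> (mnm_gaps lam i == 0%N)])) //.
  + rewrite /mult_series' raddf_sum /=; apply: eq_bigr => lam _.
    rewrite mevalZ natrM mevalX; congr (_ * _).
    case: (boolP [forall i : 'I_(k + k), ~~ odd i ==> (mnm_gaps lam i == 0%N)]).
      move=> /forallP gap0; rewrite big1 // => i _; case: ifP => oi; first by rewrite expr1n.
      by have := gap0 i; rewrite oi /= => /eqP->.
    rewrite negb_forall => /existsP[ i]; rewrite negb_imply => /andP[ei gap_neq0].
    by rewrite (bigD1 i) //= (negPf ei) expr0n (negPf gap_neq0) mul0r.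
  + exact: symplectic_unit.
  + by move=> V a U lam act_a pol_a irrU plam hw; apply: dim_symplectic_invariants.
- rewrite (@hilbert_invariants_sum _ _ _ _ (fun lam => [forall i : 'I_n, ~~ odd (lam i)])).
  + rewrite (iter_mean_sum (e := id) (s := sym_weights W l)
      (z := fun lam => (sym_mult W l lam)%:R)) // raddf_sum /=.
    apply: eq_bigr => lam _.
    have -> : mnm_tail n lam = 0%MM by apply/mnmP => i; rewrite mnmE ltn_ord mnm0E.
    rewrite mpolyX0 alg_mpolyC natrM; congr ((_ * (nat_of_bool _)%:R)%:MP).
    by apply: eq_forallb => i; rewrite ltn_ord.
  + by move=> k /orthogonal_unit.
  + by move=> V a U lam act_a pol_a irrU plam hw; apply: dim_orthogonal_invariants.
- rewrite (@hilbert_invariants_sum _ _ _ _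
    (fun lam => [forall i : 'I_n, (i.+1 < n)%N ==> ~~ odd (mnm_gaps lam i)])).
  + have lt_n : (n.-1 < n)%N by rewrite ltn_predL.
    have meanE := iter_mean_sum (e := @mnm_gaps n) (s := sym_weights W l)
      (z := fun lam => (sym_mult W l lam)%:R) (leq_pred n) (erefl (mult_series' W l)).
    rewrite (subst_var_const _ _ meanE) subst_var_sum raddf_sum /=.
    apply: eq_bigr => lam _.
    rewrite (subst_var_mnm (Ordinal lt_n)) expr1n scale1r /=.
    have -> : mnm_tail n.-1.+1 (mnm_gaps lam) = 0%MM.
      by apply/mnmP => i; rewrite mnmE prednK // ltn_ord mnm0E.
    rewrite mpolyX0 alg_mpolyC natrM; congr ((_ * (nat_of_bool _)%:R)%:MP).
    by apply: eq_forallb => i; rewrite ltn_predRL.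
  + by move=> k /andP[/orthogonal_unit].
  + by move=> V a U lam act_a pol_a irrU plam hw; apply: dim_special_orthogonal_invariants.
Qed.
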